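(* Let $\Lambda=(\Lambda_0(t,z),\dots,\Lambda_l(t,z))$ be a $(\Delta,\mathbf e)$-admissible tuple of Laurent polynomials in $\mathbb Z_p[x^{\pm1}]=\mathbb Z_p[t^{\pm1},z^{\pm1}]$. Let $D=\frac{\partial}{\partial z_v}$ for some $v\in\{1,\dots,n\}$. Assume that the determinants of the matrices $A(e_{i+1},\Delta_i,\Delta_{i+1},\Lambda_i(t,z))$, $i=0,1,\dots,l$, are Laurent polynomials all nonzero modulo $p$. Then for $1\le s\le l$ and $\ell\ge0$, $$D\Big(\sigma^\ell\big(A\big(\textstyle\sum_{a=1}^{s+1}e_a,\Delta_0,\Delta_{s+1},W_s\big)\big)\Big)\cdot\sigma^\ell\big(A\big(\textstyle\sum_{a=1}^{s+1}e_a,\Delta_0,\Delta_{s+1},W_s\big)\big)^{-1}$$ $$\equiv D\Big(\sigma^\ell\big(A\big(\textstyle\sum_{a=1}^{s}e_a,\Delta_0,\Delta_{s},W_{s-1}\big)\big)\Big)\cdot\sigma^\ell\big(A\big(\textstyle\sum_{a=1}^{s}e_a,\Delta_0,\Delta_{s},W_{s-1}\big)\big)^{-1}\pmod{p^{s+\ell}}.$$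
   Context: Let $p$ be an odd prime, $t=(t_1,\dots,t_r)$ and $z=(z_1,\dots,z_n)$ two groups of variables, $x=(t,z)$. Congruence modulo $p^s$ of Laurent polynomials over $\mathbb Z_p$ means divisibility by $p^s$ of all coefficients of the difference; for matrices it is entrywise. For a Laurent polynomial $G(w)$ put $\sigma(G)(w)=G(w^p)$ (each variable is raised to the $p$-th power); $\sigma$ and $D$ are applied to matrices entrywise. Let $l\ge0$, let $\mathbf e=(e_1,\dots,e_{l+1})$ be positive integers and $\Delta=(\Delta_0,\dots,\Delta_{l+1})$ a tuple of nonempty finite subsets of $\mathbb Z^r$, all of the same size $g$ (each with a fixed ordering). For a Laurent polynomial $F(t,z)$ let $N(F)\subset\mathbb R^r$ be its Newton polytope with respect to the $t$ variables only. The tuple $\Lambda$ is $(\Delta,\mathbf e)$-admissible if, with $N_i=N(\Lambda_i)$, for all $0\le i\le j<l$ $$\big(\Delta_i+N_i+p^{e_{i+1}}N_{i+1}+\dots+p^{e_{i+1}+\dots+e_j}N_j\big)\cap p^{e_{i+1}+\dots+e_{j+1}}\mathbb Z^r\subset p^{e_{i+1}+\dots+e_{j+1}}\Delta_{j+1}.$$ Put $W_s(x)=\Lambda_0(x)\Lambda_1(x)^{p^{e_1}}\cdots\Lambda_s(x)^{p^{e_1+\dots+e_s}}$ for $0\le s\le l$. Hasse–Witt matrix: for $m\ge1$ and finite $\Delta',\Delta''\subset\mathbb Z^r$, $A(m,\Delta',\Delta'',F(t,z))$ is the matrix with rows indexed by $u\in\Delta'$, columns by $v\in\Delta''$, and $(u,v)$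 entry the coefficient of $t^{p^mv-u}$ in $F(t,z)$ (a Laurent polynomial in $z$). Under the stated assumptions the determinants of the matrices being inverted are nonzero modulo $p$. A congruence $F_1F_2^{-1}\equiv G_1G_2^{-1}\pmod{p^k}$ of $g\times g$ matrices with Laurent polynomial entries, where $\det F_2,\det G_2$ are nonzero modulo $p$, is understood as follows: by Cramer's rule write $F_1F_2^{-1}=\frac1{\det F_2}F$ and $G_1G_2^{-1}=\frac1{\det G_2}G$ with $F,G$ Laurent polynomial matrices; the congruence means $F\cdot\det G_2\equiv G\cdot\det F_2\pmod{p^k}$. *)

(* Defs.v *)
From HB Require Import structures.
From mathcomp Require Import all_boot all_order all_algebra.
From mathcomp Require Import finmap boolp classical_sets reals monalg.

Set Implicit Arguments.
Unset Strict Implicit.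
Unset Printing Implicit Defensive.

Import GRing.Theory Num.Theory.

Local Open Scope fset_scope.
Local Open Scope ring_scope.

(* The ring of p-adic integers, as the inverse limit of the rings Z/p^n:      *)
(* the n-th component is the residue modulo p^n, represented in [0, p^n[.     *)
Record residue_seq (p : nat) := ResidueSeq {
  residue : nat -> int;
  residueP : forall n, residue n = (residue n.+1 %% (p ^ n)%:Z)%Z
}.

(* The primality proof is what makes 1 != 0 provable (the limit is the zero   *)
(* ring for p = 1).                                                           *)
Definition padic_int (p : nat) (p_pr : prime p) : Type := residue_seq p.

HB.instance Definition _ (p : nat) (p_pr : prime p) :=
  gen_eqMixin (padic_int p_pr).
HB.instance Definition _ (p : nat) (p_pr : prime p) :=
  gen_choiceMixin (padic_int p_pr).

Section PadicRing.
Variables (p : nat) (p_pr : prime p).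
Local Notation Zp := (padic_int p_pr).
Local Notation q n := ((p ^ n)%:Z).
Implicit Types (x y z : Zp).

Lemma padicP x y : residue x = residue y -> x = y.
Proof.
case: x y => [x xP] [y yP] /= eq_xy; case: y / eq_xy yP => yP.
by congr ResidueSeq; apply: Prop_irrelevance.
Qed.

Lemma modz_pexpS (a : int) n : ((a %% q n.+1)%Z %% q n)%Z = (a %% q n)%Z.
Proof.
have qS : q n.+1 = p%:Z * q n by rewrite expnS PoszM.
by rewrite [in RHS](divz_eq a (q n.+1)) [X in _ * X]qS mulrA modzMDl.
Qed.

Lemma residue_small x n : (residue x n %% q n)%Z = residue x n.
Proof. by rewrite residueP modz_mod. Qed.

Fact padic_of_subproof (u : nat -> int) :
  (forall n, (u n %% q n)%Z = (u n.+1 %% q n)%Z) ->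
  forall n, (u n %% q n)%Z = ((u n.+1 %% q n.+1)%Z %% q n)%Z.
Proof. by move=> uP n; rewrite modz_pexpS. Qed.

Definition padic_of u uP : Zp := ResidueSeq (@padic_of_subproof u uP).

Fact padic_zero_subproof n : (0 %% q n)%Z = (0 %% q n)%Z.
Proof. by []. Qed.
Fact padic_one_subproof n : (1 %% q n)%Z = (1 %% q n)%Z.
Proof. by []. Qed.
Fact padic_opp_subproof x n :
  ((- residue x n) %% q n)%Z = ((- residue x n.+1) %% q n)%Z.
Proof. by rewrite (residueP x n) modzNm. Qed.
Fact padic_add_subproof x y n :
  ((residue x n + residue y n) %% q n)%Z
  = ((residue x n.+1 + residue y n.+1) %% q n)%Z.
Proof. by rewrite (residueP x n) (residueP y n) modzDm. Qed.
Fact padic_mul_subproof x y n :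
  ((residue x n * residue y n) %% q n)%Z
  = ((residue x n.+1 * residue y n.+1) %% q n)%Z.
Proof. by rewrite (residueP x n) (residueP y n) modzMm. Qed.

Definition padic_zero := padic_of padic_zero_subproof.
Definition padic_one := padic_of padic_one_subproof.
Definition padic_opp x := padic_of (padic_opp_subproof x).
Definition padic_add x y := padic_of (padic_add_subproof x y).
Definition padic_mul x y := padic_of (padic_mul_subproof x y).

Fact padic_addA : associative padic_add.
Proof.
by move=> x y z; apply/padicP/funext=> n; rewrite /= modzDml modzDmr addrA.
Qed.
Fact padic_addC : commutative padic_add.
Proof. by move=> x y; apply/padicP/funext=> n; rewrite /= addrC. Qed.
Fact padic_add0 : left_id padic_zero padic_add.
Proof.
by move=> x; apply/padicP/funext=> n; rewrite /= modzDml add0r residue_small.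
Qed.
Fact padic_addN : left_inverse padic_zero padic_opp padic_add.
Proof. by move=> x; apply/padicP/funext=> n; rewrite /= modzDml addNr. Qed.
Fact padic_mulA : associative padic_mul.
Proof.
by move=> x y z; apply/padicP/funext=> n; rewrite /= modzMml modzMmr mulrA.
Qed.
Fact padic_mulC : commutative padic_mul.
Proof. by move=> x y; apply/padicP/funext=> n; rewrite /= mulrC. Qed.
Fact padic_mul1 : left_id padic_one padic_mul.
Proof.
by move=> x; apply/padicP/funext=> n; rewrite /= modzMml mul1r residue_small.
Qed.
Fact padic_mulDl : left_distributive padic_mul padic_add.
Proof.
move=> x y z; apply/padicP/funext=> n.
by rewrite /= modzMml modzDm mulrDl.
Qed.
Fact padic_oner_neq0 : padic_one != padic_zero.
Proof.
apply/eqP => /(congr1 (fun x : Zp => residue x 1%N)) /=.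
rewrite expn1 mod0z modz_small // ltz_nat.
exact: prime_gt1.
Qed.

HB.instance Definition _ := GRing.isZmodule.Build Zp
  padic_addA padic_addC padic_add0 padic_addN.
HB.instance Definition _ := GRing.Zmodule_isComNzRing.Build Zp
  padic_mulA padic_mulC padic_mul1 padic_mulDl padic_oner_neq0.

End PadicRing.

(* Laurent polynomials in n variables over R: the group algebra R[Z^n]. The   *)
(* coefficient of the monomial with exponent vector w is F@_w, and            *)
(* << c *g w >> is the term with coefficient c and exponent w. The library    *)
(* only equips {malg R[K]} with a product for monomial types K, where no      *)
(* nontrivial element is invertible; hence the product below.                 *)
Definition laurent (n : nat) (R : zmodType) : Type := {malg R['rV[int]_n]}.

HB.instance Definition _ (n : nat) (R : zmodType) :=
  GRing.Zmodule.copy (laurent n R) {malg R['rV[int]_n]}.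

Section LaurentRing.
Variables (n : nat) (R : comNzRingType).
Local Notation L := (laurent n R).
Implicit Types (F G H : L) (u w : 'rV[int]_n) (c : R).

Definition lterm c u : L := << c *g u >>.

Definition lone : L := lterm 1 0.

Definition lmul F G : L :=
  \sum_(u <- msupp F) \sum_(w <- msupp G) lterm (F@_u * G@_w) (u + w).

Lemma ltermD u : {morph lterm^~ u : c d / c + d}.
Proof. exact: monalgUD. Qed.

Lemma lterm0 u : lterm 0 u = 0.
Proof. exact: monalgU0. Qed.

Lemma laurentE F : F = \sum_(u <- msupp F) lterm F@_u u.
Proof. exact: monalgE. Qed.

Lemma lmulw (d1 d2 : {fset 'rV[int]_n}) F G :
  msupp F `<=` d1 -> msupp G `<=` d2 ->
  lmul F G = \sum_(u <- d1) \sum_(w <- d2) lterm (F@_u * G@_w) (u + w).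
Proof.
move=> le_d1 le_d2; rewrite /lmul (big_fset_incl _ le_d1) /=.
  apply/eq_bigr=> u _; apply/big_fset_incl => // w _ /mcoeff_outdom ->.
  by rewrite mulr0 lterm0.
move=> u _ /mcoeff_outdom F_u.
by rewrite big1 => // w _; rewrite F_u mul0r lterm0.
Qed.

Fact lmulC : commutative lmul.
Proof.
move=> F G; rewrite /lmul exchange_big /=; apply: eq_bigr => w _.
by apply: eq_bigr => u _; rewrite mulrC addrC.
Qed.

Lemma lmul0 : left_zero 0 lmul.
Proof. by move=> F; rewrite /lmul msupp0 big_seq_fset0. Qed.

Lemma lmul_term c d u w : lmul (lterm c u) (lterm d w) = lterm (c * d) (u + w).
Proof. by rewrite (lmulw msuppU_le msuppU_le) !big_seq_fset1 !mcoeffUU. Qed.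

Lemma lmul_terml c u G :
  lmul (lterm c u) G = \sum_(w <- msupp G) lterm (c * G@_w) (u + w).
Proof.
rewrite (lmulw msuppU_le (fsubset_refl _)) big_seq_fset1.
by apply/eq_bigr => w _; rewrite mcoeffUU.
Qed.

Fact lmul1 : left_id lone lmul.
Proof.
move=> F; rewrite lmul_terml [RHS]laurentE.
by apply/eq_bigr => w _; rewrite mul1r add0r.
Qed.

Fact lmulDl : left_distributive lmul +%R.
Proof.
move=> F G H.
rewrite (lmulw (msuppD_le F G) (fsubset_refl (msupp H))).
rewrite (lmulw (fsubsetUl (msupp F) (msupp G)) (fsubset_refl (msupp H))).
rewrite (lmulw (fsubsetUr (msupp F) (msupp G)) (fsubset_refl (msupp H))).
rewrite -big_split /=; apply/eq_bigr=> u _.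
rewrite -big_split /=; apply/eq_bigr=> w _.
by rewrite mcoeffD mulrDl ltermD.
Qed.

Lemma lmul_suml (I : Type) (s : seq I) (E : I -> L) G :
  lmul (\sum_(i <- s) E i) G = \sum_(i <- s) lmul (E i) G.
Proof. exact: (big_morph (lmul^~ G) (fun _ _ => lmulDl _ _ _) (lmul0 _)). Qed.

Lemma lmul_sumr (I : Type) (s : seq I) (E : I -> L) G :
  lmul G (\sum_(i <- s) E i) = \sum_(i <- s) lmul G (E i).
Proof. by rewrite lmulC lmul_suml; apply: eq_bigr => i _; rewrite lmulC. Qed.

Fact lmulA : associative lmul.
Proof.
move=> F G H; rewrite (laurentE F) !lmul_suml; apply: eq_bigr => u _.
rewrite (laurentE G) lmul_sumr !lmul_suml lmul_sumr; apply: eq_bigr => v _.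
rewrite (laurentE H) !lmul_sumr; apply: eq_bigr => w _.
by rewrite !lmul_term mulrA addrA.
Qed.

Fact lone_neq0 : lone != 0.
Proof.
apply/eqP => /(congr1 (fun F : L => F@_(0 : 'rV[int]_n)%R)) /eqP.
by rewrite mcoeffUU mcoeff0 oner_eq0.
Qed.

HB.instance Definition _ := GRing.Zmodule_isComNzRing.Build (laurent n R)
  lmulA lmulC lmul1 lmulDl lone_neq0.

End LaurentRing.

Section LaurentOperators.
Variables (n : nat) (R : comNzRingType).
Implicit Types (F G : laurent n R).

(* partial derivative with respect to the v-th variable *)
Definition lderiv (v : 'I_n) F : laurent n R :=
  \sum_(w <- msupp F) lterm (F@_w *~ w 0 v) (w - delta_mx 0 v).

(* sigma(F)(z) = F(z^p) *)
Definition lsigma (p : nat) F : laurent n R :=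
  \sum_(w <- msupp F) lterm F@_w (w *+ p).

Definition lcongr (p k : nat) F G : Prop :=
  forall w, exists c : R, F@_w - G@_w = (p ^ k)%:R * c.

Definition nonzero_modp (p : nat) F : Prop := ~ lcongr p 1 F 0.

(* F1 F2^-1 = G1 G2^-1 modulo p^k, for matrices F2 and G2 whose determinants  *)
(* are nonzero modulo p. By Cramer's rule F1 F2^-1 = (F1 adj(F2)) / det F2.   *)
Definition ratio_congr (p k g : nat) (F1 F2 G1 G2 : 'M[laurent n R]_g) : Prop :=
  [/\ nonzero_modp p (\det F2),
      nonzero_modp p (\det G2) &
      forall i j, lcongr p k ((F1 *m \adj F2) i j * \det G2)
                             ((G1 *m \adj G2) i j * \det F2)].

End LaurentOperators.

(* In the sequel S is a ring of Laurent polynomials in z, so that laurent r S *)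
(* is the ring of Laurent polynomials in (t, z), and F@_w is the coefficient  *)
(* of t^w, a Laurent polynomial in z.                                         *)

Definition hasse_witt (p r : nat) (S : comNzRingType) (g1 g2 m : nat)
    (Delta1 : g1.-tuple 'rV[int]_r) (Delta2 : g2.-tuple 'rV[int]_r)
    (F : laurent r S) : 'M[S]_(g1, g2) :=
  \matrix_(i, j) F@_(tnth Delta2 j *+ (p ^ m) - tnth Delta1 i)%R.

(* e i.+1 + ... + e j; the exponents e are indexed from 1 and e 0 is unused *)
Definition esum (e : nat -> nat) (i j : nat) : nat :=
  (\sum_(i.+1 <= a < j.+1) e a)%N.

Definition Wprod (p r : nat) (S : comNzRingType) (e : nat -> nat)
    (Lambda : nat -> laurent r S) (s : nat) : laurent r S :=
  \prod_(0 <= i < s.+1) Lambda i ^+ (p ^ esum e 0 i).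

Section Admissible.
Local Open Scope classical_set_scope.
Variables (R : realType) (r : nat).
Implicit Types (A B : set 'rV[R]_r).

Definition lattice_pt (w : 'rV[int]_r) : 'rV[R]_r := map_mx intr w.

Definition minkowski A B : set 'rV[R]_r := [set a + b | a in A & b in B].

Definition dilate (m : nat) A : set 'rV[R]_r := [set m%:R *: a | a in A].

(* the convex hull of the exponents of F *)
Definition newton (S : zmodType) (F : laurent r S) : set 'rV[R]_r :=
  [set x | exists c : 'rV[int]_r -> R,
    [/\ forall w, w \in msupp F -> 0 <= c w,
        \sum_(w <- msupp F) c w = 1 &
        x = \sum_(w <- msupp F) c w *: lattice_pt w]].

Definition admissible (p l g : nat) (S : zmodType) (e : nat -> nat)
    (Delta : nat -> g.-tuple 'rV[int]_r) (Lambda : nat -> laurent r S) : Prop :=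
  forall i j : nat, (i <= j < l)%N ->
    minkowski (lattice_pt @` [set` Delta i])
      (\big[minkowski/[set 0]]_(i <= k < j.+1)
         dilate (p ^ esum e i k) (newton (Lambda k)))
    `&` dilate (p ^ esum e i j.+1) (range lattice_pt)
    `<=` dilate (p ^ esum e i j.+1) (lattice_pt @` [set` Delta j.+1]).

End Admissible.
Arguments admissible R [r] p l [g S] e Delta Lambda.

(* Main.v *)
(* Put W(i,s) = Lambda_i Lambda_(i+1)^(p^e_(i+1)) ... Lambda_(s-1)^(...), with *)
(* exponents the powers p^E(i,k) of p, E(i,k) = e_(i+1) + ... + e_k, and let   *)
(* A(i,s) be its Hasse-Witt matrix, so that A(s,s) = 1 and the theorem is      *)
(* about A(0,s+1) and A(0,s). The "ghosts" V(i,m) are defined by               *)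
(*   W(i,s) = sum_(i < m <= s) V(i,m) sigma^E(i,m)(W(m,s));                    *)
(* as F^(p^(a+b)) = sigma^b(F^(p^a)) mod p^(a+1), they vanish modulo           *)
(* p^(m-i-1). Since V(i,m) is supported in N_i + ... + p^E(i,m-1) N_(m-1),     *)
(* admissibility turns this into                                               *)
(*   A(i,s) = sum_(i < m <= s) B(i,m) sigma^E(i,m)(A(m,s))                     *)
(* with B(i,m) divisible by p^(m-i-1). Let U_i = A(i,s)^-1 A(i,s+1). Downward  *)
(* induction on i gives U_i = sigma^E(i,m)(U_m) mod p^(s+1-m) for              *)
(* i < m <= s; as D sigma^e is divisible by p^e, it follows that D U_i = 0     *)
(* mod p^(s-i), and D U_0 = A(0,s)^-1 (D A(0,s+1) A(0,s+1)^-1                  *)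
(* - D A(0,s) A(0,s)^-1) A(0,s+1). Applying sigma^ell gains a factor p^ell.    *)
(* Inverses are avoided by writing U_i = M_i / d_i with d_i = det A(i,s): an   *)
(* element nonzero modulo p is regular modulo every p^k, because F_p[z^+-1] is *)
(* a domain.                                                                   *)

Require Import Defs.
From HB Require Import structures.
From mathcomp Require Import all_boot all_order all_algebra.
From mathcomp Require Import finmap boolp classical_sets reals monalg.
From mathcomp Require Import zify ring.

Set Implicit Arguments.
Unset Strict Implicit.
Unset Printing Implicit Defensive.

Import Order.TTheory GRing.Theory Num.Theory.

Local Open Scope ring_scope.

(** * Congruences *)

(** Suppose that raising to the power $p^b$ were exactly $\sigma^b$. Then $W(i,s)$ would equal
    $\Lambda_i\,\sigma^{e_{i+1}}(W(i+1,s))$, admissibility would factor $A(0,s+1)$ into twists of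
    the matrices $B(i,i+1)$, and $U=A(0,s)^{-1}A(0,s+1)$ would be $\sigma^{E(0,s)}(B(s,s+1))$. Its
    derivative is divisible by $p^{E(0,s)}$, hence by $p^s$, and for $X=YU$ one has
    $DX\,X^{-1}-DY\,Y^{-1}=Y\,DU\,X^{-1}$. Powers agree with $\sigma$ only up to congruences. The
    errors are collected in the ghosts, whose divisibility ([ghost_cong]) comes from
    [cong_lfrob_exp]. Their supports ([supported_ghost], [admissible_mem]) let [hasse_witt_mul] turn
    the decomposition of $W$ into a recursion for $A$. Then [quotient_cong] shows that $U$ still
    behaves like a Frobenius twist to the required precision, [deriv_quotient_cong] bounds $DU$, and
    [deriv_ratio_cong] and [sig_deriv_ratio_cong] conclude. Quotients are kept as adjugate over
    determinant; determinants cancel by [det_A_neq0], [cong_cancel] and [laurent_regular_mod]. *)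

Definition cong (V : zmodType) (N : nat) (x y : V) : Prop :=
  exists z, x - y = z *+ N.

Section Congruences.
Variables (V : zmodType) (N : nat).
Implicit Types x y z : V.

Lemma cong_refl x : cong N x x.
Proof. by exists 0; rewrite subrr mul0rn. Qed.

Lemma cong_sym x y : cong N x y -> cong N y x.
Proof. by case=> z Ez; exists (- z); rewrite mulNrn -Ez opprB. Qed.

Lemma cong_trans y x z : cong N x y -> cong N y z -> cong N x z.
Proof.
by case=> a Ea [b Eb]; exists (a + b); rewrite mulrnDl -Ea -Eb addrA subrK.
Qed.

Lemma congD x y x' y' : cong N x y -> cong N x' y' -> cong N (x + x') (y + y').
Proof.
by case=> a Ea [b Eb]; exists (a + b); rewrite mulrnDl -Ea -Eb opprD addrACA.
Qed.

Lemma congN x y : cong N x y -> cong N (- x) (- y).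
Proof. by case=> a Ea; exists (- a); rewrite mulNrn -Ea opprD. Qed.

Lemma congB0 x y : cong N (x - y) 0 <-> cong N x y.
Proof. by split=> -[z Ez]; exists z; rewrite -Ez subr0. Qed.

Lemma cong_mulrn x : cong N (x *+ N) 0.
Proof. by exists x; rewrite subr0. Qed.

Lemma cong0P x : cong N x 0 <-> exists z, x = z *+ N.
Proof. by split=> -[z Ez]; exists z; rewrite -Ez subr0. Qed.

Lemma cong_sum (I : eqType) (s : seq I) (P : pred I) (E F : I -> V) :
  (forall i, i \in s -> P i -> cong N (E i) (F i)) ->
  cong N (\sum_(i <- s | P i) E i) (\sum_(i <- s | P i) F i).
Proof.
move=> EF; rewrite big_seq_cond [X in cong _ _ X]big_seq_cond.
elim/big_ind2: _ => [|a b c d|i /andP[]];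
  [exact: cong_refl|exact: congD|exact: EF].
Qed.

Lemma cong_sum0 (I : eqType) (s : seq I) (P : pred I) (E : I -> V) :
  (forall i, i \in s -> P i -> cong N (E i) 0) ->
  cong N (\sum_(i <- s | P i) E i) 0.
Proof.
move=> E0; rewrite big_seq_cond; elim/big_ind: _ => [|x y hx hy|i /andP[]].
- exact: cong_refl.
- by rewrite -[X in cong _ _ X]addr0; apply: congD.
- exact: E0.
Qed.

Lemma cong_dvd M x y : (N %| M)%N -> cong M x y -> cong N x y.
Proof.
by case/dvdnP=> k -> [z Ez]; exists (z *+ k); rewrite Ez mulrnA.
Qed.

Lemma congMn M x y : cong N x y -> cong (N * M) (x *+ M) (y *+ M).
Proof. by case=> z Ez; exists z; rewrite -mulrnBl Ez mulrnA. Qed.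

Lemma cong_raddf (U : zmodType) (f : {additive V -> U}) x y :
  cong N x y -> cong N (f x) (f y).
Proof. by case=> z Ez; exists (f z); rewrite -raddfB Ez raddfMn. Qed.

End Congruences.

Lemma cong1 (V : zmodType) (x y : V) : cong 1 x y.
Proof. by exists (x - y); rewrite mulr1n. Qed.

Lemma cong_pow (V : zmodType) (p m n : nat) (x y : V) :
  (m <= n)%N -> cong (p ^ n) x y -> cong (p ^ m) x y.
Proof. by move=> le_mn; apply/cong_dvd/dvdn_exp2l. Qed.

Section CongruencesMatrix.
Variables (S : comNzRingType) (N : nat).

Lemma cong_mx m n (A B : 'M[S]_(m, n)) :
  (forall i j, cong N (A i j) (B i j)) <-> cong N A B.
Proof.
split=> [AB|[Z EZ] i j]; last first.
  by exists (Z i j); move/matrixP: EZ => /(_ i j); rewrite !mxE mulmxnE.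
have /choice[Z EZ] : forall ij : 'I_m * 'I_n,
    exists z, A ij.1 ij.2 - B ij.1 ij.2 = z *+ N by move=> ij; apply: AB.
exists (\matrix_(i, j) Z (i, j)); apply/matrixP=> i j.
by rewrite mulmxnE !mxE (EZ (i, j)).
Qed.

Lemma cong_mulmx m n k (A B : 'M[S]_(m, n)) (C D : 'M[S]_(n, k)) :
  cong N A B -> cong N C D -> cong N (A *m C) (B *m D).
Proof.
move=> AB CD; apply: (@cong_trans _ _ (B *m C)).
  exact: (cong_raddf (mulmxr C)).
exact: (cong_raddf (mulmx B)).
Qed.

(** The moduli multiply: this is how the divisibility of a ghost compensates for a weaker congruence
    on the matrix that it multiplies. *)
Lemma cong_mulmx_pow m n k M (A : 'M[S]_(m, n)) (C D : 'M[S]_(n, k)) :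
  cong M A 0 -> cong N C D -> cong (M * N) (A *m C) (A *m D).
Proof.
case/cong0P=> Z -> [Y EY]; exists (Z *m Y).
rewrite -mulmxBr EY (raddfMn (mulmx (Z *+ M))) /=.
by rewrite -[(Z *+ M) *m Y]/(mulmxr Y (Z *+ M)) raddfMn mulrnA.
Qed.

End CongruencesMatrix.

Section CongruencesRing.
Variables (S : comNzRingType).
Implicit Types x y z : S.

Lemma congM N x y x' y' : cong N x y -> cong N x' y' ->
  cong N (x * x') (y * y').
Proof.
move=> xy xy'; apply: (@cong_trans _ _ (y * x')).
  by case: xy => z Ez; exists (z * x'); rewrite -mulrBl Ez mulrnAl.
by case: xy' => z Ez; exists (y * z); rewrite -mulrBr Ez mulrnAr.
Qed.

Lemma congMl N z x y : cong N x y -> cong N (z * x) (z * y).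
Proof. by apply: congM; apply: cong_refl. Qed.

Lemma congMr N z x y : cong N x y -> cong N (x * z) (y * z).
Proof. by move=> h; apply: congM => //; apply: cong_refl. Qed.

Lemma congM0 M N x y z : cong M x 0 -> cong N y z ->
  cong (M * N) (x * y) (x * z).
Proof.
case/cong0P=> a -> [b Eb]; exists (a * b).
by rewrite -mulrBr Eb mulrnAl mulrnAr -mulrnA mulnC.
Qed.

Lemma congX N k x y : cong N x y -> cong N (x ^+ k) (y ^+ k).
Proof.
move=> xy; elim: k => [|k IHk]; first exact: cong_refl.
by rewrite !exprS; apply: congM.
Qed.

Lemma cong_prod N (I : finType) (E F : I -> S) :
  (forall i, cong N (E i) (F i)) -> cong N (\prod_i E i) (\prod_i F i).
Proof.
move=> EF; elim/big_ind2: _ => [|x y x' y' h h'|//]; first exact: cong_refl.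
exact: congM.
Qed.

Lemma cong_det N n (A B : 'M[S]_n) : cong N A B -> cong N (\det A) (\det B).
Proof.
move/cong_mx => AB; apply: cong_sum => s _ _; apply: congMl.
by apply: cong_prod.
Qed.

(** In $x^p-y^p=(x-y)\sum_i x^{p-1-i}y^i$ the sum is congruent to $p\,y^{p-1}$ modulo $p$, which
    gains one factor $p$. *)
Lemma cong_exp_lift p k x y :
  cong (p ^ k.+1) x y -> cong (p ^ k.+2) (x ^+ p) (y ^+ p).
Proof.
move=> xy; have xyp : cong p x y.
  by apply: cong_dvd xy; rewrite expnS dvdn_mulr.
apply/congB0; rewrite subrXX.
rewrite -[X in cong _ _ X](mulr0 (x - y)).
rewrite [(p ^ k.+2)%N]expnSr; apply: congM0; first exact/congB0.
apply: (@cong_trans _ _ (\sum_(i < p) y ^+ p.-1)).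
  apply: cong_sum => i _ _.
  have -> : y ^+ p.-1 = y ^+ (p.-1 - i) * y ^+ i.
    by rewrite -exprD subnK //; have := ltn_ord i; lia.
  exact/congMr/congX.
by rewrite sumr_const card_ord; apply: cong_mulrn.
Qed.

Lemma cong_exp_lifts p k a x y :
  cong (p ^ k.+1) x y -> cong (p ^ (a + k).+1) (x ^+ (p ^ a)) (y ^+ (p ^ a)).
Proof.
move=> xy; elim: a => [|a IHa]; first by rewrite !expr1.
by rewrite [(p ^ a.+1)%N]expnSr !exprM addSn; apply: cong_exp_lift.
Qed.

Lemma cong_frobeniusD p x y : prime p ->
  cong p ((x + y) ^+ p) (x ^+ p + y ^+ p).
Proof.
move=> p_pr; have p_gt0 := prime_gt0 p_pr.
rewrite exprDn -(big_mkord xpredT (fun i => x ^+ (p - i) * y ^+ i *+ 'C(p, i))).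
rewrite big_nat_recr //= big_ltn //.
rewrite subn0 expr0 mulr1 bin0 mulr1n subnn expr0 mul1r binn mulr1n.
apply: congD; last exact: cong_refl.
rewrite -[X in cong _ _ X]addr0; apply: congD; first exact: cong_refl.
apply: cong_sum0 => i; rewrite mem_index_iota => i_bounds _.
have /dvdnP[c ->] := prime_dvd_bin p_pr i_bounds.
by rewrite mulrnA; apply: cong_mulrn.
Qed.

Lemma cong_frobeniusXD p b x y : prime p ->
  cong p ((x + y) ^+ (p ^ b)) (x ^+ (p ^ b) + y ^+ (p ^ b)).
Proof.
move=> p_pr; elim: b => [|b IHb]; first by rewrite !expr1; apply: cong_refl.
rewrite [(p ^ b.+1)%N]expnSr !exprM;
  apply: cong_trans (cong_frobeniusD _ _ p_pr).
exact: congX.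
Qed.

(** Absence of $p$-torsion together with Euclid's lemma for $p$: the form of regularity that passes
    from a ring to its Laurent polynomials. *)
Definition regular_mod (p : nat) (S : comNzRingType) : Prop :=
  (forall x : S, x *+ p = 0 -> x = 0) /\
  (forall x y : S, cong p (x * y) 0 -> cong p x 0 \/ cong p y 0).

(** Induction on $k$: Euclid's lemma gives $x-y=pw$, one factor $p$ cancels by torsion-freeness, and
    the induction applies to $w$. *)
Lemma cong_cancel p k x y z : regular_mod p S -> ~ cong p z 0 ->
  cong (p ^ k) (z * x) (z * y) -> cong (p ^ k) x y.
Proof.
move=> [p_reg p_prime] z_neq0;
  rewrite -(congB0 _ (z * x)) -(congB0 _ x) -mulrBr.
move: (x - y) => {x y} x.
elim: k x => [|k IHk] x; first by move=> _; apply: cong1.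
move=> zx; have zxp : cong p (z * x) 0.
  by apply: cong_dvd zx; rewrite expnS dvdn_mulr.
have [//|/cong0P[w Ew]] := p_prime z x zxp.
rewrite {}Ew in zx *; have p_inj (u v : S) : u *+ p = v *+ p -> u = v.
  by move=> /eqP; rewrite -subr_eq0 -mulrnBl => /eqP/p_reg/eqP;
    rewrite subr_eq0 => /eqP.
have /cong0P[u Eu] : cong (p ^ k) w 0.
  apply: IHk; case/cong0P: zx => u Eu; apply/cong0P; exists u.
  by apply: p_inj; rewrite -mulrnAr Eu expnSr mulrnA.
by apply/cong0P; exists u; rewrite Eu -mulrnA expnSr.
Qed.

End CongruencesRing.

(** * p-adic integers *)

Section PadicIntegers.
Variables (p : nat) (p_pr : prime p).
Local Notation Zp := (padic_int p_pr).
Implicit Types x y : Zp.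

Let p_gt0 : (0 < p)%N := prime_gt0 p_pr.

Lemma residueD x y n :
  residue (x + y) n = ((residue x n + residue y n) %% (p ^ n)%:Z)%Z.
Proof. by []. Qed.

Lemma residueM x y n :
  residue (x * y) n = ((residue x n * residue y n) %% (p ^ n)%:Z)%Z.
Proof. by []. Qed.

Lemma residueN x n : residue (- x) n = ((- residue x n) %% (p ^ n)%:Z)%Z.
Proof. by []. Qed.

Lemma residue0 n : residue (0 : Zp) n = 0.
Proof. by rewrite /= mod0z. Qed.

Lemma residueMn x m n :
  residue (x *+ m) n = ((residue x n * m%:Z) %% (p ^ n)%:Z)%Z.
Proof.
elim: m => [|m IHm]; first by rewrite mulr0n mulr0 residue0 mod0z.
by rewrite mulrS residueD IHm modzDmr -addn1 PoszD mulrDr mulr1 addrC.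
Qed.

Lemma residue_lt x n : (0 <= residue x n < (p ^ n)%:Z).
Proof.
have q_gt0 : (0 < (p ^ n)%:Z) by rewrite ltz_nat expn_gt0 p_gt0.
by rewrite -residue_small modz_ge0 ?gt_eqF //= ltz_pmod.
Qed.

Lemma cong_padic x : cong p x 0 <-> residue x 1 = 0.
Proof.
split=> [/cong0P[z ->]|x1].
  by rewrite residueMn expn1 modzMl.
have dvd_x n : (p%:Z %| residue x n.+1)%Z.
  elim: n => [|n /dvdz_mod0P IHn]; first by rewrite x1 dvdz0.
  have := residueP x n.+1 => E; rewrite E in IHn.
  apply/dvdz_mod0P; rewrite -IHn [in RHS]expnS mulnC PoszM.
  rewrite (divz_eq (residue x n.+2) ((p ^ n)%:Z * p%:Z)) modzMDl.
  by rewrite mulrA modzMDl modz_mod // modz_dvdm // dvdz_mull.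
(* The $n$-th residue of $x/p$ is the residue of $x$ at level $n+1$, divided by $p$. *)
have c_coh n : ((residue x n.+1 %/ p)%Z %% (p ^ n)%:Z)%Z =
               ((residue x n.+2 %/ p)%Z %% (p ^ n)%:Z)%Z.
  have p_neq0 : p%:Z != 0 by rewrite gt_eqF.
  apply: (mulIf p_neq0); rewrite !mulz_modl // ?ltz_nat //.
  rewrite !divzK // -PoszM -expnSr.
  by rewrite -residueP residue_small.
apply/cong0P; exists (padic_of p_pr c_coh); apply/padicP/funext => n.
rewrite residueMn /= modzMml divzK // -residueP //.
Qed.

Lemma padic_regular_mod : regular_mod p Zp.
Proof.
split=> [x xp0|x y /cong_padic].
  apply/padicP/funext => n; rewrite residue0.
  have := congr1 (fun z : Zp => residue z n.+1) xp0.
  rewrite residueMn residue0 => /dvdz_mod0P.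
  rewrite expnSr PoszM dvdz_mul2r ?gt_eqF // => /dvdz_mod0P xn0;
    rewrite -[RHS]xn0.
  exact: residueP.
rewrite residueM => /dvdz_mod0P; rewrite expn1.
rewrite dvdzE abszM Euclid_dvdM // => /orP[]dvd; [left|right]; apply/cong_padic.
  by rewrite -residue_small expn1; apply/dvdz_mod0P.
by rewrite -residue_small expn1; apply/dvdz_mod0P.
Qed.

(** Modulo $p$ a $p$-adic integer is a natural number, to which Fermat's little theorem applies.
    This starts the Frobenius congruences, as $\sigma$ fixes scalars. *)
Lemma padic_fermat b (c : Zp) : cong p (c ^+ (p ^ b)) c.
Proof.
have [a Ea] : exists a : nat, cong p c a%:R.
  exists `|residue c 1|%N; apply/congB0/cong_padic.
  rewrite residueD residueN residueMn -[residue (1 : Zp) 1]/(1 %% (p ^ 1)%:Z)%Z.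
  have /andP[c_ge0 _] := residue_lt c 1.
  by rewrite modzMml mul1r gez0_abs // modzNm modzDmr addrN mod0z.
apply: cong_trans (congX _ Ea) _; apply: cong_trans (cong_sym Ea).
rewrite -natrX.
have fermat : a ^ (p ^ b) = a %[mod p].
  elim: b => [|b IHb]; first by rewrite expn1.
  by rewrite expnSr expnM fermat_little.
wlog le_am : / (a <= a ^ (p ^ b))%N.
  by apply; case: (a) => // a';
    rewrite -[X in (X <= _)%N]expn1 leq_pexp2l ?expn_gt0 ?p_gt0.
apply/congB0; rewrite -natrB //.
have /dvdnP[k ->] : (p %| a ^ (p ^ b) - a)%N by rewrite -eqn_mod_dvd //;
  apply/eqP.
by rewrite natrM mulr_natr; apply: cong_mulrn.
Qed.
End PadicIntegers.

(** * Laurent polynomials *)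

Section LaurentCoefficients.
Variables (n : nat) (S : comNzRingType).
Local Notation L := (laurent n S).
Implicit Types (F G : L) (u w : 'rV[int]_n).

Lemma mcoeff_lterm (c : S) u w : (lterm c u : L)@_w = c *+ (u == w).
Proof. exact: mcoeffU. Qed.

Lemma laurentP F G : (forall w, F@_w = G@_w) -> F = G.
Proof. by move/malgP. Qed.

Lemma mcoeff_laurentMn F w k : (F *+ k)@_w = F@_w *+ k.
Proof. exact: mcoeffMn. Qed.

Lemma mcoeff_laurent_sum (I : Type) (s : seq I) (P : pred I) (E : I -> L) w :
  (\sum_(i <- s | P i) E i)@_w = \sum_(i <- s | P i) (E i)@_w.
Proof. exact: (raddf_sum (mcoeff w)). Qed.

Lemma mcoeff_laurentM F G w :
  (F * G)@_w = \sum_(u <- msupp F) F@_u * G@_(w - u).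
Proof.
rewrite -[F * G]/(lmul F G) mcoeff_laurent_sum; apply: eq_bigr => u _.
rewrite mcoeff_laurent_sum.
under eq_bigr => v _ do rewrite mcoeff_lterm.
have addE (v : 'rV[int]_n) : (u + v == w) = (v == w - u) by rewrite [RHS]eq_sym
  subr_eq addrC eq_sym.
case: (msuppP G (w - u)) => [Gw|Gw].
  rewrite (bigD1_seq (w - u)) ?fset_uniq //= [u + _]addrC subrK eqxx.
  rewrite big1 ?addr0 // => v v_neq.
  by rewrite addE (negPf v_neq).
rewrite big1_seq ?mulr0 // => v /andP[_ v_in]; rewrite addE.
by case: eqP v_in => // ->; rewrite (negPf Gw).
Qed.

Lemma cong_laurent N F G : (forall w, cong N F@_w G@_w) <-> cong N F G.
Proof.
split=> [FG|[H EH] w]; last first.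
  by exists H@_w; rewrite -mcoeff_laurentMn -EH -mcoeffB.
suff H0 F' : (forall w, cong N F'@_w 0) -> cong N F' 0.
  apply/congB0/H0 => w; have -> : (F - G)@_w = F@_w - G@_w by exact: mcoeffB.
  exact/congB0.
move=> F0; have /choice[h Eh] w : exists z, F'@_w = z *+ N by apply/cong0P.
apply/cong0P.
exists (\sum_(w <- msupp F') lterm (h w) w).
rewrite [LHS]laurentE -sumrMnl; apply: eq_bigr => w _.
by rewrite Eh /lterm monalgUMn.
Qed.

Lemma lcongrE p k F G : lcongr p k F G <-> cong (p ^ k) F G.
Proof.
rewrite -cong_laurent; split=> FG w; have [c Ec] := FG w; exists c.
  by rewrite Ec mulr_natl.
by rewrite Ec mulr_natl.
Qed.

Lemma nonzero_modpE p F : nonzero_modp p F <-> ~ cong p F 0.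
Proof. by rewrite /nonzero_modp lcongrE expn1. Qed.

End LaurentCoefficients.

Section LaurentExtension.
Variables (n : nat) (S : comNzRingType) (V : zmodType).
Variable h : 'rV[int]_n -> {additive S -> V}.
Local Notation L := (laurent n S).
Implicit Types (F G : L) (u w : 'rV[int]_n).

(** Common form of $\sigma$ and $D$: an additive map given on terms, where each exponent carries its
    own map on coefficients. *)
Definition lext F : V := \sum_(w <- msupp F) h w F@_w.

Lemma lextw (d : {fset 'rV[int]_n}) F : (msupp F `<=` d)%fset ->
  lext F = \sum_(w <- d) h w F@_w.
Proof.
move=> le_d; rewrite /lext (big_fset_incl _ le_d) // => w _ /mcoeff_outdom ->.
exact: raddf0.
Qed.

Fact lext_zmod_morphism : zmod_morphism lext.
Proof.
move=> F G.
rewrite (lextw (msuppB_le F G)) (lextw (fsubsetUl (msupp F) (msupp G))).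
rewrite (lextw (fsubsetUr (msupp F) (msupp G))) -sumrB.
by apply: eq_bigr => w _; rewrite -raddfB mcoeffB.
Qed.

HB.instance Definition _ := GRing.isZmodMorphism.Build L V lext
  lext_zmod_morphism.

Lemma lext_lterm c u : lext (lterm c u) = h u c.
Proof. by rewrite (lextw msuppU_le) big_seq_fset1 mcoeffUU. Qed.

End LaurentExtension.

Section LaurentTermsGenerate.
Variables (n : nat) (S : comNzRingType) (V : zmodType).
Local Notation L := (laurent n S).

(** Terms generate additively, so multiplicativity of $\sigma$, the Leibniz rule and the chain rule
    need checking on terms only. *)
Lemma laurent_additive_eq (f g : L -> V) :
  zmod_morphism f -> zmod_morphism g ->
  (forall c u, f (lterm c u) = g (lterm c u)) -> f =1 g.
Proof.
move=> fD gD fg F.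
have [f' f'E] : exists f' : {additive L -> V}, f =1 f'.
  by exists (HB.pack_for {additive L -> V} f
    (GRing.isZmodMorphism.Build L V f fD)).
have [g' g'E] : exists g' : {additive L -> V}, g =1 g'.
  by exists (HB.pack_for {additive L -> V} g
    (GRing.isZmodMorphism.Build L V g gD)).
rewrite f'E g'E [F]laurentE !raddf_sum; apply: eq_bigr => w _.
by rewrite -f'E -g'E.
Qed.

Lemma laurent_biadditive_eq (B1 B2 : L -> L -> V) :
  (forall G, zmod_morphism (B1^~ G)) -> (forall F, zmod_morphism (B1 F)) ->
  (forall G, zmod_morphism (B2^~ G)) -> (forall F, zmod_morphism (B2 F)) ->
  (forall c u d w, B1 (lterm c u) (lterm d w) = B2 (lterm c u) (lterm d w)) ->
  forall F G, B1 F G = B2 F G.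
Proof.
move=> B1l B1r B2l B2r B12 F G; move: F.
apply: laurent_additive_eq => // c u; move: G.
exact: laurent_additive_eq.
Qed.

End LaurentTermsGenerate.

Lemma lterm_mul n (S : comNzRingType) (c d : S) (u w : 'rV[int]_n) :
  lterm c u * lterm d w = lterm (c * d) (u + w) :> laurent n S.
Proof. exact: lmul_term. Qed.

Lemma lterm_one n (S : comNzRingType) : lterm (1 : S) 0 = 1 :> laurent n S.
Proof. by []. Qed.

Lemma ltermB n (S : comNzRingType) (c d : S) (u : 'rV[int]_n) :
  lterm (c - d) u = lterm c u - lterm d u :> laurent n S.
Proof. exact: monalgUB. Qed.

Lemma ltermMn n (S : comNzRingType) (c : S) (u : 'rV[int]_n) k :
  lterm (c *+ k) u = lterm c u *+ k :> laurent n S.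
Proof. exact: monalgUMn. Qed.

(** * Frobenius substitutions *)

Section FrobeniusSubstitution.
Variables (n : nat) (S : comNzRingType).
Local Notation L := (laurent n S).
Implicit Types (F G : L).

(** Acting on the coefficients as well lets one construction serve twice: with [phi] the identity it
    is the substitution in $z$, and with [phi] that substitution it acts on $t$ and $z$ together. *)
Definition lfrob (q : nat) (phi : {rmorphism S -> S}) : L -> L :=
  lext (fun w => mkmalgU (w *+ q) \o phi).

Variables (q : nat) (phi : {rmorphism S -> S}).
Local Notation sig := (lfrob q phi).

HB.instance Definition _ := GRing.Additive.copy sig
  (lext (fun w => mkmalgU (w *+ q) \o phi)).

Lemma lfrob_lterm (c : S) u : sig (lterm c u) = lterm (phi c) (u *+ q).
Proof. exact: lext_lterm. Qed.

Fact lfrob_monoid_morphism : monoid_morphism sig.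
Proof.
split=> [|F G]; first by rewrite -lterm_one lfrob_lterm rmorph1 mul0rn.
apply: (laurent_biadditive_eq (B1 := fun F G => sig (F * G))
  (B2 := fun F G => sig F * sig G)) => [{}G F1 F2|{}F G1 G2|{}G F1 F2|{}F G1
    G2|c u d w].
- by rewrite mulrBl raddfB.
- by rewrite mulrBr raddfB.
- by rewrite raddfB mulrBl.
- by rewrite raddfB mulrBr.
by rewrite lterm_mul !lfrob_lterm lterm_mul rmorphM mulrnDl.
Qed.

HB.instance Definition _ := GRing.isMonoidMorphism.Build L L sig
  lfrob_monoid_morphism.

Lemma mcoeff_lfrob (q_gt0 : (0 < q)%N) F w : (sig F)@_(w *+ q) = phi F@_w.
Proof.
rewrite {1}[F]laurentE (raddf_sum sig) mcoeff_laurent_sum /=.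
under eq_bigr => u _ do rewrite lfrob_lterm mcoeff_lterm.
have inj_q (u v : 'rV[int]_n) : (u *+ q == v *+ q) = (u == v).
  apply/eqP/eqP => [E|->//]; apply/matrixP => i j.
  move/matrixP/(_ i j): E; rewrite !mulmxnE => /eqP.
  by rewrite -subr_eq0 -mulrnBl mulrn_eq0 gtn_eqF // subr_eq0 => /eqP.
case: (msuppP F w) => [Fw|Fw].
  rewrite (bigD1_seq w) ?fset_uniq //= eqxx big1 ?addr0 // => u u_neq.
  by rewrite inj_q (negPf u_neq).
rewrite big1_seq ?rmorph0 // => u /andP[_ u_in]; rewrite inj_q.
by case: eqP u_in => // ->; rewrite (negPf Fw).
Qed.

Lemma msupp_lfrob F w : w \in msupp (sig F) ->
  exists2 u, u \in msupp F & w = u *+ q.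
Proof.
rewrite -mcoeff_neq0 => sFw.
have /hasP[u Fu /eqP Eu] : has (fun u => w == u *+ q) (msupp F).
  apply: contra_neqT sFw => /hasPn no_u.
  rewrite [F]laurentE (raddf_sum sig) mcoeff_laurent_sum /= big1_seq // => u
    /andP[_ Fu].
  by rewrite lfrob_lterm mcoeff_lterm eq_sym (negPf (no_u u Fu)).
by exists u.
Qed.

End FrobeniusSubstitution.

Lemma lfrob_comp n (S : comNzRingType) a b (phi psi chi : {rmorphism S -> S}) :
  (forall c, phi (psi c) = chi c) ->
  forall F : laurent n S, lfrob a phi (lfrob b psi F) = lfrob (a * b) chi F.
Proof.
move=> chiE; apply: laurent_additive_eq => [F G|F G|c u].
- by rewrite !raddfB.
- by rewrite raddfB.
by rewrite !lfrob_lterm chiE mulrnA mulrnAC.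
Qed.

Lemma lfrob1 n (S : comNzRingType) (F : laurent n S) : lfrob 1 idfun F = F.
Proof.
move: F; apply: laurent_additive_eq => [F G|//|c u]; first by rewrite raddfB.
exact: lfrob_lterm.
Qed.

Lemma iter_lsigma n (S : comNzRingType) p k (F : laurent n S) :
  iter k (@lsigma n S p) F = lfrob (p ^ k) idfun F.
Proof.
elim: k => [|k IHk]; first by rewrite lfrob1.
rewrite iterS IHk expnS.
exact: (@lfrob_comp n S p (p ^ k) idfun idfun idfun (fun=> erefl)).
Qed.

(** Modulo $p$ the power $p^b$ is additive, so only terms matter, and there the hypothesis on
    coefficients suffices. It is used in $z$ over $\mathbb Z_p$ first, and then in $t$, where the
    first use supplies the hypothesis. *)
Lemma cong_lfrob_prime n (S : comNzRingType) p b (phi : {rmorphism S -> S}) :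
  prime p -> (forall c : S, cong p (c ^+ (p ^ b)) (phi c)) ->
  forall F : laurent n S, cong p (F ^+ (p ^ b)) (lfrob (p ^ b) phi F).
Proof.
move=> p_pr phiP F; rewrite [F]laurentE raddf_sum /=.
elim/big_rec2: _ => [|w F1 F2 _ IHF].
  by rewrite expr0n expn_eq0 (gtn_eqF (prime_gt0 p_pr)); apply: cong_refl.
apply: cong_trans (cong_frobeniusXD _ _ _ p_pr) _; apply: congD IHF.
have ltermX (c : S) (u : 'rV[int]_n) k : (lterm c u : laurent n S) ^+ k = lterm
  (c ^+ k) (u *+ k).
  elim: k => [|k IHk]; first by rewrite !expr0 mulr0n lterm_one.
  by rewrite !exprS IHk lterm_mul mulrS.
rewrite ltermX lfrob_lterm.
exact: (cong_raddf (mkmalgU (w *+ p ^ b))).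
Qed.

Lemma cong_lfrob_exp n (S : comNzRingType) p b a (phi : {rmorphism S -> S}) :
  prime p -> (forall c : S, cong p (c ^+ (p ^ b)) (phi c)) ->
  forall F : laurent n S,
  cong (p ^ a.+1) (F ^+ (p ^ (b + a))) (lfrob (p ^ b) phi (F ^+ (p ^ a))).
Proof.
move=> p_pr phiP F; rewrite expnD exprM rmorphXn /= -[a in X in cong X]addn0.
by apply: cong_exp_lifts; rewrite expn1; apply: cong_lfrob_prime.
Qed.

(** * Partial derivatives *)

Section PartialDerivative.
Variables (n : nat) (S : comNzRingType) (v : 'I_n).
Local Notation L := (laurent n S).
Implicit Types (F G : L) (w : 'rV[int]_n).

Definition lderiv_term w (c : S) : L :=
  lterm (c *~ w 0 v) (w - delta_mx 0 v).

Fact lderiv_term_zmod_morphism w : zmod_morphism (lderiv_term w).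
Proof. by move=> c d; rewrite /lderiv_term mulrzBl ltermB. Qed.

HB.instance Definition _ w := GRing.isZmodMorphism.Build S L (lderiv_term w)
  (lderiv_term_zmod_morphism w).

HB.instance Definition _ := GRing.Additive.copy (@lderiv n S v)
  (lext lderiv_term).

Lemma lderiv_lterm (c : S) u :
  lderiv v (lterm c u) = lterm (c *~ u 0 v) (u - delta_mx 0 v).
Proof. exact: (lext_lterm lderiv_term). Qed.

Lemma lderivM F G : lderiv v (F * G) = lderiv v F * G + F * lderiv v G.
Proof.
apply: (laurent_biadditive_eq (B1 := fun F G => lderiv v (F * G))
  (B2 := fun F G => lderiv v F * G + F * lderiv v G))
  => [{}G F1 F2|{}F G1 G2|{}G F1 F2|{}F G1 G2|c u d w].
- by rewrite mulrBl raddfB.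
- by rewrite mulrBr raddfB.
- by rewrite raddfB !mulrBl addrACA -opprD.
- by rewrite raddfB !mulrBr addrACA -opprD.
rewrite lterm_mul !lderiv_lterm !lterm_mul [u - _ + w]addrAC [u + (w - _)]addrA.
rewrite -(@ltermD n S); apply: (congr2 (@lterm n S)) => //.
by rewrite mxE mulrzDr mulrzAl mulrzAr.
Qed.

(** Chain rule for $z\mapsto z^q$; with $q=p^a$, the factor $q$ is the source of the divisibility of
    derivatives. *)
Lemma lderiv_lfrob q : (0 < q)%N -> forall F,
  lderiv v (lfrob q idfun F) =
  lterm 1 (delta_mx 0 v *+ q.-1) * lfrob q idfun (lderiv v F) *+ q.
Proof.
move=> q_gt0; apply: laurent_additive_eq => [F G|F G|c w].
- by rewrite !raddfB.
- by rewrite !raddfB mulrBr mulrnBl.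
rewrite lfrob_lterm !lderiv_lterm lfrob_lterm lterm_mul mul1r -ltermMn.
apply: (congr2 (@lterm n S)).
  by rewrite mulmxnE -[w 0 v *+ q]mulr_natr natz mulrzA -pmulrn.
case: q q_gt0 => // q' _; rewrite mulrnBl addrCA [delta_mx 0 v *+ _.+1]mulrSr.
by congr (_ + _); rewrite opprD addrA subrr add0r.
Qed.

End PartialDerivative.

(** * Euclid's lemma for $p$ in Laurent polynomial rings *)

Lemma separating_functional n (s : seq 'rV[int]_n) :
  exists f : {additive 'rV[int]_n -> int}, {in s &, injective f}.
Proof.
(* Vectors are read as coefficient lists of polynomials and evaluated at an integer; one that is not
   a root of any nonzero difference separates the list. *)
pose P := \prod_(d <- [seq uv.1 - uv.2 | uv <- allpairs pair s s] | d != 0)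
  rVpoly d.
have P_neq0 : P != 0.
  rewrite prodf_seq_neq0; apply/allP => d _; apply/implyP; apply: contra_neq.
  by move=> /(congr1 (poly_rV (d := n))); rewrite rVpolyK raddf0.
have [x Px] : exists x, ~~ root P x.
  apply: contrapT => all_root; pose t := [seq Posz i | i <- iota 0 (size P)].
  suff: (size t < size P)%N by rewrite size_map size_iota ltnn.
  apply: max_poly_roots => //; last first.
    by rewrite map_inj_uniq ?iota_uniq // => i j [].
  apply/allP => x _; apply: contrapT => Px; apply: all_root.
  by exists x; apply/negP.
exists (horner_eval x \o rVpoly) => u w us ws /= fuw; apply/eqP.
apply: contraNT Px => uw; rewrite rootE /P horner_prod.
rewrite prodf_seq_eq0; apply/hasP; exists (u - w).
  by apply/mapP; exists (u, w) => //; apply/allpairsP; exists (u, w).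
rewrite subr_eq0 uw /= raddfB /= hornerD hornerN subr_eq0; exact/eqP.
Qed.

Lemma seq_argmax (T : eqType) (f : T -> int) (s : seq T) (x : T) : x \in s ->
  exists2 m, m \in s & forall y, y \in s -> f y <= f m.
Proof.
elim: s x => // a s IHs x _; case: s IHs => [|b s] IHs.
  by exists a; rewrite ?mem_head // => y; rewrite inE => /eqP->.
have [m ms m_max] := IHs b (mem_head _ _).
have [le_am|lt_ma] := leP (f a) (f m).
  exists m; first by rewrite inE ms orbT.
  by move=> y; rewrite inE => /orP[/eqP->//|/m_max].
exists a; first exact: mem_head.
move=> y; rewrite inE => /orP[/eqP->//|/m_max le_ym].
exact: le_trans le_ym (ltW lt_ma).
Qed.

(** Leading-term argument modulo $p$: let $u$, $w$ maximize a functional $f$ over the exponents of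
    $F$, $G$ whose coefficients are prime to $p$. Since $f$ is injective on the support of $F$, the
    maximum at $u$ is strict, so the coefficient of $FG$ at $u+w$ is $F_uG_w$ modulo $p$. *)
Lemma laurent_regular_mod n (S : comNzRingType) p :
  regular_mod p S -> regular_mod p (laurent n S).
Proof.
move=> [p_reg p_prime]; split=> [F pF|F G FG0].
  apply: laurentP => w; rewrite mcoeff0; apply: p_reg.
  by rewrite -mcoeff_laurentMn pF mcoeff0.
apply: contrapT => /not_orP[F_neq0 G_neq0].
have extremal (H : laurent n S) (f : 'rV[int]_n -> int) : ~ cong p H 0 ->
  exists2 m, ~ cong p H@_m 0 &
    forall y, ~ cong p H@_y 0 -> f y <= f m.
  move=> H_neq0.
  have [y Hy] : exists y, ~ cong p H@_y 0.
    apply: contrapT => noy; apply/H_neq0/cong_laurent => w.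
    by rewrite mcoeff0; apply: contrapT => Hw; apply: noy; exists w.
  have inP z : ~ cong p H@_z 0 <-> z \in [seq z <- msupp H | `[< ~ cong p H@_z
    0 >]].
    rewrite mem_filter; split=> [Hz|/andP[/asboolP]//]; apply/andP; split.
      exact/asboolP.
    by rewrite -mcoeff_neq0; apply/eqP => Hz0; apply: Hz; rewrite Hz0;
      apply: cong_refl.
  have /inP/(seq_argmax f)[m /inP Hm m_max] := Hy.
  by exists m => // z /inP/m_max.
have [f f_inj] := separating_functional (msupp F).
have [u Fu u_max] := extremal F f F_neq0.
have [w Gw w_max] := extremal G f G_neq0.
have supp_neq0 y : ~ cong p F@_y 0 -> y \in msupp F.
  move=> Fy; rewrite -mcoeff_neq0; apply/eqP => Fy0.
  by apply: Fy; rewrite Fy0; apply: cong_refl.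
have /cong_laurent/(_ (u + w)) := FG0; rewrite mcoeff0 mcoeff_laurentM => FGuw.
have [] // := p_prime F@_u G@_w.
apply: cong_trans FGuw; apply: cong_sym.
rewrite (bigD1_seq u) ?fset_uniq ?supp_neq0 //= [u + w - u]addrAC subrr add0r.
rewrite -[X in cong _ _ X]addr0; apply: congD; first exact: cong_refl.
apply: cong_sum0 => y Fy y_neq.
have [Fy0|Fy_neq0] := pselect (cong p F@_y 0).
  by rewrite -[X in cong _ _ X](mul0r G@_(u + w - y)); apply: congMr.
rewrite -[X in cong _ _ X](mulr0 F@_y); apply: congMl.
apply: contrapT => /w_max; rewrite raddfB raddfD /=.
have := u_max y Fy_neq0; rewrite le_eqVlt => /orP[/eqP fyu _|].
  by case/eqP: y_neq; apply: f_inj => //; apply: supp_neq0.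
by move: (f u : int) (f w : int) (f y : int); lia.
Qed.

Lemma lfrob_neq0_mod n (S : comNzRingType) p q (F : laurent n S) : (0 < q)%N ->
  ~ cong p F 0 -> ~ cong p (lfrob q idfun F) 0.
Proof.
move=> q_gt0 F_neq0 sF0; apply/F_neq0/cong_laurent => w.
move/cong_laurent/(_ (w *+ q)): sF0; by rewrite mcoeff_lfrob // !mcoeff0.
Qed.

(** * Ghosts *)

Lemma strong_rec_exists (T : nmodType) (f : nat -> (nat -> T) -> T) :
  (forall s g h, (forall m, (m < s)%N -> g m = h m) -> f s g = f s h) ->
  exists V : nat -> T, forall s, V s = f s V.
Proof.
move=> f_ext.
(* [pre n] tabulates the values below [n] and is $0$ from [n] on. *)
pose fix pre n : nat -> T :=
  if n is k.+1 then fun m => if m == k then f k (pre k) else pre k m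
  else fun=> 0.
exists (fun s => f s (pre s)) => s; apply: f_ext.
elim: s => // s IHs m; rewrite ltnS leq_eqVlt /=.
by case: eqP => [->|_] //=; apply: IHs.
Qed.

Section PartialSums.
Variable e : nat -> nat.

Lemma esum0 i : esum e i i = 0%N.
Proof. by rewrite /esum big_geq. Qed.

Lemma esumD i m s : (i <= m <= s)%N -> (esum e i m + esum e m s)%N = esum e i s.
Proof. by case/andP=> le_im le_ms; rewrite /esum -big_cat_nat. Qed.

Lemma esum1 i : esum e i i.+1 = e i.+1.
Proof. by rewrite /esum big_nat1. Qed.

Lemma leq_esum N i s : (forall a, (1 <= a <= N)%N -> (0 < e a)%N) ->
  (s <= N)%N -> (s - i <= esum e i s)%N.
Proof.
move=> e_gt0 le_sN; rewrite /esum.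
apply: (@leq_trans (\sum_(i.+1 <= a < s.+1) 1));
  first by rewrite sum_nat_const_nat muln1.
rewrite big_nat_cond [X in (_ <= X)%N]big_nat_cond; apply: leq_sum => a.
by case/andP=> /andP[ia a_s] _; apply: e_gt0; lia.
Qed.

End PartialSums.

Section Ghosts.
Variables (T : comNzRingType) (p : nat) (e : nat -> nat).
Variables (tau : nat -> {rmorphism T -> T}) (Lambda : nat -> T).

(** The range is half open, so that [Wtail i i] is $1$ and $W_s$ is [Wtail 0 s.+1]. *)
Definition Wtail i s : T := \prod_(i <= k < s) Lambda k ^+ (p ^ esum e i k).

Lemma Wtail_nil i : Wtail i i = 1.
Proof. by rewrite /Wtail big_geq. Qed.

Lemma WtailS i s : (i <= s)%N ->
  Wtail i s.+1 = Wtail i s * Lambda s ^+ (p ^ esum e i s).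
Proof. by move=> le_is; rewrite /Wtail big_nat_recr. Qed.

(** The term [m = s] is [V s] itself, so these equations determine the ghosts recursively. *)
Definition ghost_decomposition i (V : nat -> T) : Prop :=
  forall s, (i < s)%N ->
  Wtail i s = \sum_(i.+1 <= m < s.+1) V m * tau (esum e i m) (Wtail m s).

Lemma ghosts_exist i : exists V, ghost_decomposition i V.
Proof.
have [|V VE] := @strong_rec_exists T (fun s V => Wtail i s -
   \sum_(i.+1 <= m < s) V m * tau (esum e i m) (Wtail m s)).
  move=> s g h gh; congr (_ - _); apply: eq_big_nat => m /andP[_ lt_ms].
  by rewrite gh.
exists V => s lt_is; rewrite big_nat_recr //= Wtail_nil rmorph1 mulr1 [V s]VE.
by rewrite addrC subrK.
Qed.

Lemma ghostE i V s : ghost_decomposition i V -> (i < s)%N ->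
  V s = Wtail i s - \sum_(i.+1 <= m < s) V m * tau (esum e i m) (Wtail m s).
Proof.
move=> VE lt_is; rewrite (VE s lt_is) big_nat_recr //= Wtail_nil rmorph1 mulr1.
by rewrite addrAC subrr add0r.
Qed.

Hypothesis frobP : forall a b F, (0 < b)%N ->
  cong (p ^ a.+1) (F ^+ (p ^ (b + a))) (tau b (F ^+ (p ^ a))).

(** Multiplying the decomposition of $W(i,s)$ by $\Lambda_s^{p^{E(i,s)}}$ and subtracting the terms
    $m\le s$ of that of $W(i,s+1)$ writes $V_{s+1}$ as a sum over $m$ of $V_m$ times a Frobenius
    defect of $\Lambda_s$. The defect is divisible by $p^{E(m,s)+1}$, where $E(m,s)\ge s-m$, and
    $V_m$ by $p^{m-i-1}$: in total $p^{s-i}$. *)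
Lemma ghost_cong N i V s : (forall a, (1 <= a <= N)%N -> (0 < e a)%N) ->
  ghost_decomposition i V -> (i < s <= N)%N -> cong (p ^ (s - i.+1)) (V s) 0.
Proof.
move=> e_gt0 VE; elim/ltn_ind: s => -[//|s] IHs /andP[].
rewrite ltnS leq_eqVlt => /orP[/eqP<- _|lt_is le_sN].
  by rewrite subnn; apply: cong1.
have -> : V s.+1 = \sum_(i.+1 <= m < s.+1) V m * (tau (esum e i m) (Wtail m s) *
    (Lambda s ^+ (p ^ esum e i s) -
     tau (esum e i m) (Lambda s ^+ (p ^ esum e m s)))).
  rewrite (ghostE VE) ?ltnS 1?ltnW // WtailS 1?ltnW // (VE s lt_is) mulr_suml.
  rewrite -sumrB; apply: eq_big_nat => m /andP[_ le_ms].
  by rewrite WtailS // rmorphM !mulrBr !mulrA.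
apply: cong_sum0 => m; rewrite mem_index_iota ltnS => /andP[lt_im le_ms] _.
rewrite -(mulr0 (V m)).
have -> : (s.+1 - i.+1)%N = (m - i.+1 + (s - m).+1)%N by lia.
rewrite expnD; apply: congM0; first by apply: IHs; lia.
rewrite -(mulr0 (tau (esum e i m) (Wtail m s))); apply/congMl/congB0.
have := leq_esum m e_gt0 (ltnW le_sN) => le_E.
have Ei_gt0 : (0 < esum e i m)%N.
  by have := @leq_esum e N i m e_gt0; lia.
rewrite -(@esumD e i m s) ?(ltnW lt_im) //.
exact: (cong_pow _ (frobP _ _ Ei_gt0)).
Qed.

End Ghosts.

(** * Dwork congruences for matrices *)

Section ScaledMatrices.
Variables (L : comNzRingType) (N : nat).

Lemma cong_scale m n (c : L) (A B : 'M[L]_(m, n)) :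
  cong N A B -> cong N (c *: A) (c *: B).
Proof. by case=> Z EZ; exists (c *: Z); rewrite -scalerBr EZ scalerMnr. Qed.

Lemma cong_scale_cancel p k m n (c : L) (A B : 'M[L]_(m, n)) :
  regular_mod p L -> ~ cong p c 0 ->
  cong (p ^ k) (c *: A) (c *: B) -> cong (p ^ k) A B.
Proof.
move=> reg c_neq0 /cong_mx cAB; apply/cong_mx => i j.
by apply: (cong_cancel reg c_neq0); have := cAB i j; rewrite !mxE.
Qed.

Lemma cong_map_mx (L' : comNzRingType) (f : {additive L -> L'}) m n
    (A B : 'M[L]_(m, n)) :
  cong N A B -> cong N (map_mx f A) (map_mx f B).
Proof.
by move/cong_mx=> AB; apply/cong_mx => i j; rewrite !mxE; apply: cong_raddf.
Qed.

End ScaledMatrices.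

(** If $m/d\equiv m_1/d_1$ and $D(m_1/d_1)\equiv0$, then $D(m/d)\equiv0$, with denominators cleared
    at the price of a factor $d_1^2$. The combination of the hypotheses eliminates [m1] and
    [Dm1]. *)
Lemma cong_quotient_rule (L : comNzRingType) N (d d1 m m1 Dd Dd1 Dm Dm1 : L) :
  cong N (d1 * m) (d * m1) ->
  cong N (Dd1 * m + d1 * Dm) (Dd * m1 + d * Dm1) ->
  cong N (d1 * Dm1) (Dd1 * m1) ->
  cong N (d1 * (d1 * (d * Dm))) (d1 * (d1 * (Dd * m))).
Proof.
move=> [a Ea] [b Eb] [c Ec].
exists (d * d1 * b - (d1 * Dd + d * Dd1) * a + d * d * c).
rewrite mulrnDl mulrnBl -!mulrnAr -Ea -Eb -Ec; ring.
Qed.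

Section DworkMatrices.
Variables (L : comNzRingType) (p g : nat) (e : nat -> nat) (l : nat).
Hypothesis reg : regular_mod p L.
Hypothesis e_gt0 : forall a, (1 <= a <= l.+1)%N -> (0 < e a)%N.

Variable sig : nat -> {rmorphism L -> L}.
Hypothesis sigD : forall a b x, sig a (sig b x) = sig (a + b) x.
Hypothesis sig_neq0 : forall a x, ~ cong p x 0 -> ~ cong p (sig a x) 0.

Variables A B : nat -> nat -> 'M[L]_g.
Hypothesis A_diag : forall i, (i <= l.+1)%N -> A i i = 1%:M.
Hypothesis A_rec : forall i s, (i < s <= l.+1)%N ->
  A i s = \sum_(i.+1 <= m < s.+1) B i m *m map_mx (sig (esum e i m)) (A m s).
Hypothesis B_cong : forall i m, (i < m <= l.+1)%N ->
  cong (p ^ (m - i.+1)) (B i m) 0.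
Hypothesis B_det : forall i, (i <= l)%N -> ~ cong p (\det (B i i.+1)) 0.

(** Modulo $p$ only the term $m=i+1$ of the recursion survives, so $\det A(i,s)$ is a product of two
    factors that are nonzero modulo $p$. *)
Lemma det_A_neq0 i s : (i <= s <= l.+1)%N -> ~ cong p (\det (A i s)) 0.
Proof.
move: {2}(s - i)%N (erefl (s - i)%N) => k; elim: k i => [|k IHk] i Ek i_bounds.
  have -> : s = i by lia.
  rewrite A_diag ?det1; last by lia.
  (* If $p$ divided $1$ it would divide everything, against [B_det]. *)
  move=> one0; apply: (B_det (leq0n l)).
  by rewrite -[X in cong _ X _]mulr1 -(mulr0 (\det (B 0%N 1%N))); apply: congMl.
move/cong_sym=> A0; apply: (@sig_neq0 (esum e i i.+1) (\det (A i.+1 s))).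
  by apply: IHk; lia.
case: reg => _ p_prime; have le_il : (i <= l)%N by lia.
suff prod0 : cong p (\det (B i i.+1) * sig (esum e i i.+1) (\det (A i.+1 s))) 0.
  by have [/(B_det le_il)|] := p_prime _ _ prod0.
apply: cong_sym; apply: cong_trans A0 _.
rewrite -det_map_mx -det_mulmx; apply: cong_det.
rewrite A_rec; last by lia.
rewrite big_ltn; last by lia.
rewrite -[X in cong _ _ X]addr0; apply: congD; first exact: cong_refl.
apply: cong_sum0 => m; rewrite mem_index_iota => m_bounds _.
rewrite -(mul0mx _ (map_mx (sig (esum e i m)) (A m s))).
apply: cong_mulmx; last exact: cong_refl.
by rewrite -[p]expn1; apply: (cong_pow _ (B_cong _)); lia.
Qed.

(** * Comparison of $A(i,s)$ with $A(i,s+1)$ *)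

Section Consecutive.
Variable s : nat.
Hypothesis le_sl : (s <= l)%N.

Let X i := A i s.+1.
Let Y i := A i s.
Let d i := \det (Y i).
Let M i := \adj (Y i) *m X i.

Let d_neq0 i : (i <= s)%N -> ~ cong p (d i) 0.
Proof. by move=> le_is; apply: det_A_neq0; lia. Qed.

Let YM i : Y i *m M i = d i *: X i.
Proof. by rewrite mulmxA mul_mx_adj mul_scalar_mx. Qed.

(* [M i / d i] is the matrix [A(i,s)^-1 A(i,s+1)];
  modulo [p^(s+1-m)] it agrees *)
(* with the Frobenius twist of [M m / d m].                                    
  *)
Lemma quotient_cong i m : (i < m <= s)%N ->
  cong (p ^ (s.+1 - m)) (sig (esum e i m) (d m) *: M i)
                        (d i *: map_mx (sig (esum e i m)) (M m)).
Proof.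
move: {2}(s - i)%N (erefl (s - i)%N) => k.
elim: k i m => [|k IHk] i m Ek m_bounds; first by lia.
pose dt m := sig (esum e i m) (d m).
pose Mt m := map_mx (sig (esum e i m)) (M m).
have dt_neq0 m' : (m' <= s)%N -> ~ cong p (dt m') 0.
  by move=> le_ms; apply/sig_neq0/d_neq0.
(* The induction hypothesis at $i+1$, twisted by $\sigma^{e_{i+1}}$. *)
have IH m' : (i < m' <= s)%N ->
    cong (p ^ (s.+1 - m')) (dt m' *: Mt i.+1) (dt i.+1 *: Mt m').
  case/andP; rewrite leq_eqVlt => /orP[/eqP<- _|lt_im le_ms];
    first exact: cong_refl.
  have := IHk i.+1 m' ltac:(lia) ltac:(lia).
  move/(cong_map_mx (sig (esum e i i.+1))); rewrite !map_mxZ /= !sigD esumD;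
    last by lia.
  congr (cong _ _ (_ *: _)); apply/matrixP => a b.
  by rewrite !mxE sigD esumD //; lia.
(* The recursions for [X i] and [Y i] are compared term by term: [B i m'] contributes $p^{m'-i-1}$
   and [IH] contributes $p^{s+1-m'}$. The extra term $m'=s+1$ of [X i] is itself divisible by
   $p^{s-i}$. *)
have X_cong : cong (p ^ (s - i)) (dt i.+1 *: X i) (Y i *m Mt i.+1).
  rewrite /X /Y A_rec; last by lia.
  rewrite (A_rec (s := s)); last by lia.
  rewrite big_nat_recr /=; last by lia.
  rewrite A_diag ?map_mx1 ?mulmx1; last by lia.
  rewrite scalerDr scaler_sumr mulmx_suml -[X in cong _ _ X]addr0.
  apply: congD; last first.
    by rewrite -(scaler0 _ (dt i.+1)) -[(s - i)%N]subSS;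
      apply/cong_scale/B_cong; lia.
  apply: cong_sum => m'; rewrite mem_index_iota => m'_bounds _.
  rewrite scalemxAr -mulmxA.
  have -> : (s - i)%N = (m' - i.+1 + (s.+1 - m'))%N by lia.
  rewrite expnD; apply: cong_mulmx_pow; first by apply: B_cong; lia.
  apply: (cong_scale_cancel reg (dt_neq0 m' _)); first by lia.
  rewrite scalerA mulrC -scalerA -map_mxZ -[A m' s.+1]/(X m') -YM map_mxM.
  rewrite !scalemxAr; apply: cong_mulmx; first exact: cong_refl.
  by apply/cong_sym/IH; lia.
have Q1 : cong (p ^ (s - i)) (dt i.+1 *: M i) (d i *: Mt i.+1).
  rewrite -[X in cong _ _ X]mul_scalar_mx -mul_adj_mx -mulmxA /M scalemxAr.
  by apply: cong_mulmx X_cong; apply: cong_refl.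
(* [Q1] is the case $m=i+1$; the general one follows through $M_{i+1}/d_{i+1}$, using [IH]. *)
apply: (cong_scale_cancel reg (dt_neq0 i.+1 _)); first by lia.
rewrite -/(dt m) -/(Mt m) [X in cong _ _ X]scalerA [dt i.+1 * _]mulrC -scalerA.
apply: cong_trans (cong_scale _ (IH m m_bounds)).
rewrite !scalerA ![_ * dt m]mulrC -!scalerA; apply: cong_scale.
by apply: cong_pow Q1; lia.
Qed.

Variable D : {additive L -> L}.
Hypothesis D_leibniz : forall x y, D (x * y) = D x * y + x * D y.
Hypothesis D_sig : forall a, exists u, forall x,
  D (sig a x) = u * sig a (D x) *+ p ^ a.

Lemma deriv_mulmx m n k (U : 'M[L]_(m, n)) (V : 'M[L]_(n, k)) :
  map_mx D (U *m V) = map_mx D U *m V + U *m map_mx D V.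
Proof.
apply/matrixP => i j; rewrite !mxE raddf_sum -big_split /=.
by apply: eq_bigr => a _; rewrite !mxE D_leibniz.
Qed.

Lemma deriv_scale m n (c : L) (U : 'M[L]_(m, n)) :
  map_mx D (c *: U) = D c *: U + c *: map_mx D U.
Proof. by apply/matrixP => i j; rewrite !mxE D_leibniz. Qed.

(* [D (M i / d i)] vanishes modulo [p^(s-i)]. *)
Lemma deriv_quotient_cong i : (i <= s)%N ->
  cong (p ^ (s - i)) (d i *: map_mx D (M i)) (D (d i) *: M i).
Proof.
move: {2}(s - i)%N (erefl (s - i)%N) => k.
elim: k i => [|k IHk] i Ek le_is; first by rewrite Ek; apply: cong1.
have Q1 := @quotient_cong i i.+1 ltac:(lia).
rewrite subSS in Q1; set a := esum e i i.+1 in Q1.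
have a_gt0 : (0 < a)%N by rewrite /a esum1; apply: e_gt0; lia.
set d1 := sig a (d i.+1) in Q1; set M1 := map_mx (sig a) (M i.+1) in Q1.
have d1_neq0 : ~ cong p d1 0 by apply/sig_neq0/d_neq0; lia.
have [u Du] := D_sig a.
(* The induction hypothesis at $i+1$ gives only $p^{s-i-1}$; the factor $p^a$ from $D\sigma^a$, with
   $a\ge1$, makes up the difference. *)
have DM1 : cong (p ^ (s - i)) (d1 *: map_mx D M1) (D d1 *: M1).
  have -> : d1 *: map_mx D M1 =
      (u *: map_mx (sig a) (d i.+1 *: map_mx D (M i.+1))) *+ p ^ a.
    apply/matrixP => x y; rewrite mulmxnE !mxE Du rmorphM mulrnAr;
      congr (_ *+ _).
    by rewrite /d1 mulrCA.
  have -> : D d1 *: M1 =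
      (u *: map_mx (sig a) (D (d i.+1) *: M i.+1)) *+ p ^ a.
    apply/matrixP => x y; rewrite mulmxnE !mxE Du rmorphM mulrnAl;
      congr (_ *+ _).
    by rewrite mulrA.
  apply: (@cong_pow _ _ _ (s - i.+1 + a)); first by lia.
  by rewrite expnD; apply/congMn/cong_scale/cong_map_mx/IHk; lia.
(* Two cancellations, for the factor $d_1^2$ of [cong_quotient_rule]. *)
apply: (cong_scale_cancel reg d1_neq0); apply: (cong_scale_cancel reg d1_neq0).
apply/cong_mx => x y; rewrite !mxE.
apply: (@cong_quotient_rule _ _ _ _ _ (M1 x y) _ (D d1) _ (D (M1 x y))).
- by move/cong_mx/(_ x y): Q1; rewrite !mxE.
- by move/(cong_map_mx D)/cong_mx/(_ x y): Q1; rewrite !mxE !D_leibniz.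
- by move/cong_mx/(_ x y): DM1; rewrite !mxE.
Qed.

(** Differentiating $YM=dX$ and using $d\,DM\equiv(Dd)M$ gives $(DY)M\equiv d\,DX$. Multiplication
    by $\mathrm{adj}\,X$ on the right then concludes, as $M\,\mathrm{adj}\,X=\det
    X\cdot\mathrm{adj}\,Y$. *)
Lemma deriv_ratio_cong i : (i <= s)%N ->
  cong (p ^ (s - i)) (d i *: (map_mx D (X i) *m \adj (X i)))
                     (\det (X i) *: (map_mx D (Y i) *m \adj (Y i))).
Proof.
move=> le_is; have DM := deriv_quotient_cong le_is.
have DYM : cong (p ^ (s - i)) (map_mx D (Y i) *m M i) (d i *: map_mx D (X i)).
  apply: (cong_scale_cancel reg (d_neq0 le_is)).
  have := congr1 (map_mx D) (YM i); rewrite deriv_mulmx deriv_scale => E.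
  have -> : map_mx D (Y i) *m M i =
      D (d i) *: X i + d i *: map_mx D (X i) - Y i *m map_mx D (M i).
    by rewrite -E addrK.
  rewrite addrAC scalerDr -[X in cong _ _ X]add0r.
  apply: congD; last exact: cong_refl.
  rewrite scalerBr scalerA mulrC -scalerA -YM.
  rewrite (scalemxAr (D (d i))) (scalemxAr (d i)) -mulmxBr.
  rewrite -(mulmx0 _ (Y i)); apply: cong_mulmx; first exact: cong_refl.
  by apply/congB0/cong_sym.
have := cong_mulmx DYM (cong_refl _ (\adj (X i))).
rewrite /M -!mulmxA mul_mx_adj -scalemxAl !mul_mx_scalar -scalemxAr.
exact: cong_sym.
Qed.

(** Both sides are $p^a u$ times $\sigma^a$ of the sides of [deriv_ratio_cong], hence the gain of
    $a$ in the exponent. *)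
Lemma sig_deriv_ratio_cong a i x y : (i <= s)%N ->
  cong (p ^ (s - i + a))
    ((map_mx D (map_mx (sig a) (X i)) *m \adj (map_mx (sig a) (X i))) x y
       * \det (map_mx (sig a) (Y i)))
    ((map_mx D (map_mx (sig a) (Y i)) *m \adj (map_mx (sig a) (Y i))) x y
       * \det (map_mx (sig a) (X i))).
Proof.
move=> le_is; have [u Du] := D_sig a.
have ratioE (U : 'M[L]_g) c :
    (map_mx D (map_mx (sig a) U) *m \adj (map_mx (sig a) U)) x y * sig a c =
    u * map_mx (sig a) (c *: (map_mx D U *m \adj U)) x y *+ p ^ a.
  rewrite -map_mx_adj; have -> : map_mx D (map_mx (sig a) U) =
      (u *: map_mx (sig a) (map_mx D U)) *+ p ^ a.
    by apply/matrixP => j k; rewrite mulmxnE !mxE Du.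
  rewrite scalerMnl -scalemxAl -map_mxM !mxE rmorphM mulrnAl mulrnAl -mulrA.
  by rewrite [_ * sig a c]mulrC.
rewrite !det_map_mx !ratioE expnD; apply/congMn/congMl.
by have /cong_mx/(_ x y) := cong_map_mx (sig a) (deriv_ratio_cong le_is).
Qed.


End Consecutive.
End DworkMatrices.

(** * Newton polytopes *)

Section MinkowskiSums.
Local Open Scope classical_set_scope.
Variables (R : realType) (r : nat).
Implicit Types (A B C : set 'rV[R]_r).

Lemma minkowskiP A B x :
  minkowski A B x <-> exists a b, [/\ A a, B b & x = a + b].
Proof.
split=> [[a Aa [b Bb <-]]|[a [b [Aa Bb ->]]]]; first by exists a, b.
by exists a => //; exists b.
Qed.

Fact minkowskiA : associative (@minkowski R r).
Proof.
move=> A B C; apply/seteqP; split=> x /minkowskiP.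
  case=> a [bc [Aa /minkowskiP[b [c [Bb Cc ->]]] ->]]; rewrite addrA.
  by apply/minkowskiP; exists (a + b), c; split=> //; apply/minkowskiP;
    exists a, b.
case=> ab [c [/minkowskiP[a [b [Aa Bb ->]]] Cc ->]]; rewrite -addrA.
by apply/minkowskiP; exists a, (b + c); split=> //; apply/minkowskiP;
  exists b, c.
Qed.

Fact minkowski0s : left_id [set 0] (@minkowski R r).
Proof.
move=> A; apply/seteqP; split=> x;
  first by case/minkowskiP=> a [b [-> Ab ->]]; rewrite add0r.
by move=> Ax; apply/minkowskiP; exists 0, x; rewrite add0r.
Qed.

Fact minkowskis0 : right_id [set 0] (@minkowski R r).
Proof.
move=> A; apply/seteqP; split=> x;
  first by case/minkowskiP=> a [b [Ab -> ->]]; rewrite addr0.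
by move=> Ax; apply/minkowskiP; exists x, 0; rewrite addr0.
Qed.

HB.instance Definition _ := Monoid.isLaw.Build (set 'rV[R]_r) [set 0]
  (@minkowski R r) minkowskiA minkowski0s minkowskis0.

Lemma dilate_minkowski m A B :
  dilate m (minkowski A B) = minkowski (dilate m A) (dilate m B).
Proof.
apply/seteqP; split=> x.
  case=> _ /minkowskiP[a [b [Aa Bb ->]]] <-; rewrite scalerDr.
  by apply/minkowskiP; exists (m%:R *: a), (m%:R *: b); split=> //;
    [exists a|exists b].
case/minkowskiP=> _ [_ [[a Aa <-] [b Bb <-] ->]]; rewrite -scalerDr.
by exists (a + b) => //; apply/minkowskiP; exists a, b.
Qed.

Lemma dilate_set0 m : dilate m [set 0 : 'rV[R]_r] = [set 0].
Proof.
apply/seteqP; split=> x; first by case=> _ -> <-; rewrite scaler0.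
by move->; exists 0; rewrite ?scaler0.
Qed.

Lemma dilate_dilate m k A : dilate m (dilate k A) = dilate (m * k) A.
Proof.
apply/seteqP; split=> x.
  by case=> _ [a Aa <-] <-; exists a; rewrite ?natrM ?scalerA.
by case=> a Aa <-; exists (k%:R *: a); [exists a|rewrite natrM scalerA].
Qed.

Lemma lattice_ptD (u w : 'rV[int]_r) :
  lattice_pt R (u + w) = lattice_pt R u + lattice_pt R w.
Proof. exact: map_mxD. Qed.

Lemma lattice_ptMn (u : 'rV[int]_r) m :
  lattice_pt R (u *+ m) = m%:R *: lattice_pt R u.
Proof. by rewrite scaler_nat /lattice_pt raddfMn. Qed.

Lemma lattice_pt_inj : injective (@lattice_pt R r).
Proof.
move=> u w /matrixP uw; apply/matrixP => i j.
by have := uw i j; rewrite !mxE => /eqP; rewrite eqr_int => /eqP.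
Qed.

End MinkowskiSums.

Section Supports.
Local Open Scope classical_set_scope.
Variables (R : realType) (r : nat) (S : comNzRingType).
Local Notation T := (laurent r S).
Implicit Types (F G : T) (A B C : set 'rV[R]_r).

Definition supported F A : Prop :=
  forall w, w \in msupp F -> A (lattice_pt R w).

Lemma supported0 A : supported 0 A.
Proof. by move=> w; rewrite msupp0 inE. Qed.

Lemma supportedD F G A : supported F A -> supported G A -> supported (F + G) A.
Proof.
move=> FA GA w /(fsubsetP (msuppD_le F G)); rewrite in_fsetU.
by case/orP=> [/FA|/GA].
Qed.

Lemma supportedN F A : supported F A -> supported (- F) A.
Proof. by move=> FA w; rewrite msuppN; apply: FA. Qed.

Lemma supported_sum (I : eqType) (s : seq I) (P : pred I) (E : I -> T) A :
  (forall i, i \in s -> P i -> supported (E i) A) ->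
  supported (\sum_(i <- s | P i) E i) A.
Proof.
move=> EA; rewrite big_seq_cond; elim/big_ind: _ => [|F G|i /andP[]].
- exact: supported0.
- exact: supportedD.
- exact: EA.
Qed.

Lemma supportedM F G A B :
  supported F A -> supported G B -> supported (F * G) (minkowski A B).
Proof.
move=> FA GB w; rewrite -mcoeff_neq0 mcoeff_laurentM => FGw.
have /hasP[u Fu] : has (fun u => G@_(w - u) != 0) (msupp F).
  apply: contra_neqT FGw => /hasPn no_u; rewrite big1_seq // => u /andP[_ Fu].
  by have := no_u u Fu; rewrite negbK => /eqP->; rewrite mulr0.
rewrite mcoeff_neq0 => Gwu; apply/minkowskiP.
exists (lattice_pt R u), (lattice_pt R (w - u)); split; [exact: FA|exact: GB|].
by rewrite -lattice_ptD addrC subrK.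
Qed.

Lemma supported1 : supported 1 [set 0].
Proof.
move=> w; rewrite -mcoeff_neq0 -[1 : T]lterm_one mcoeff_lterm.
by case: (eqVneq 0 w) => [<- _|_ /eqP//]; rewrite /= /lattice_pt map_mx0.
Qed.

Lemma supported_lfrob q (phi : {rmorphism S -> S}) F A :
  supported F A -> supported (lfrob q phi F) (dilate q A).
Proof.
move=> FA w /msupp_lfrob[u /FA Au ->]; exists (lattice_pt R u) => //.
by rewrite lattice_ptMn.
Qed.

Lemma supported_newton F : supported F (newton F).
Proof.
move=> w Fw; exists (fun u => (u == w)%:R); split=> [u _||].
- exact: ler0n.
- rewrite (bigD1_seq w) ?fset_uniq //= eqxx big1 ?addr0 // => u /negPf->.
  by [].
rewrite (bigD1_seq w) ?fset_uniq //= eqxx scale1r big1 ?addr0 // => u /negPf->.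
by rewrite scale0r.
Qed.

(** Convexity: $(m+1)x+y$ is $m+2$ times a weighted mean of $x$ and $y$. For $m=0$ and $F=0$ the
    polytope is empty while $F^0=1$, so $m$ must be positive. *)
Lemma supported_exp F m : (0 < m)%N ->
  supported (F ^+ m) (dilate m (newton F)).
Proof.
case: m => // m _; elim: m => [|m IHm].
  by move=> w Fw; exists (lattice_pt R w);
    [apply: supported_newton|rewrite scale1r].
rewrite exprSr => w /(supportedM IHm (@supported_newton F)).
case/minkowskiP=> _ [b [[_ [c [c_ge0 c_sum ->]] <-] [d [d_ge0 d_sum ->]] ->]].
have m_neq0 : m.+2%:R != 0 :> R by rewrite pnatr_eq0.
exists (\sum_(u <- msupp F) ((m.+1%:R * c u + d u) / m.+2%:R) *: lattice_pt R
  u).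
  exists (fun u => (m.+1%:R * c u + d u) / m.+2%:R); split=> // [u Fu|].
    by rewrite divr_ge0 ?ler0n ?addr_ge0 ?d_ge0 ?mulr_ge0 ?ler0n ?c_ge0.
  rewrite -mulr_suml big_split /= -mulr_sumr c_sum d_sum mulr1.
  by rewrite natr1 divff.
rewrite !scaler_sumr -big_split /=; apply: eq_bigr => u _.
by rewrite !scalerA mulrC divfK // scalerDl.
Qed.

End Supports.

Section GhostSupports.
Local Open Scope classical_set_scope.
Variables (R : realType) (r p : nat) (e : nat -> nat) (S : comNzRingType).
Local Notation T := (laurent r S).
Variables (phi : nat -> {rmorphism S -> S}) (Lambda : nat -> T).
Hypothesis p_gt0 : (0 < p)%N.

Let tau b : {rmorphism T -> T} := lfrob (p ^ b) (phi b).
Let W := Wtail p e Lambda.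

Definition newton_tail i s : set 'rV[R]_r :=
  \big[@minkowski R r/[set 0]]_(i <= k < s)
     dilate (p ^ esum e i k) (newton (Lambda k)).

Lemma supported_Wtail i s : supported (W i s) (newton_tail i s).
Proof.
rewrite /W /Wtail /newton_tail; elim/big_rec2: _ => [|k A F _ FA].
  exact: supported1.
apply: supportedM FA; apply: supported_exp.
by rewrite expn_gt0 p_gt0.
Qed.

Lemma newton_tail_cat i m s : (i <= m <= s)%N ->
  newton_tail i s =
  minkowski (newton_tail i m) (dilate (p ^ esum e i m) (newton_tail m s)).
Proof.
case/andP=> le_im le_ms.
rewrite /newton_tail (big_cat_nat le_im le_ms) /=; congr minkowski.
rewrite (big_morph _ (@dilate_minkowski R r _) (@dilate_set0 R r _)).
rewrite big_nat_cond [RHS]big_nat_cond; apply: eq_bigr => k.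
case/andP=> /andP[le_mk _] _.
by rewrite dilate_dilate -expnD esumD // le_im.
Qed.

(** By recursion: $W(i,s)$ and each $V_m\,\sigma^{E(i,m)}(W(m,s))$ live on the same Minkowski sum,
    cut at $m$ in the second case. *)
Lemma supported_ghost i V s : ghost_decomposition p e tau Lambda i V ->
  (i < s)%N -> supported (V s) (newton_tail i s).
Proof.
move=> VE; elim/ltn_ind: s => s IHs lt_is; rewrite (ghostE VE lt_is).
apply: supportedD; first exact: supported_Wtail.
apply: supportedN; apply: supported_sum => m; rewrite mem_index_iota.
case/andP=> lt_im lt_ms _.
have le_ims : (i <= m <= s)%N by rewrite (ltnW lt_im) (ltnW lt_ms).
rewrite (newton_tail_cat le_ims).
apply: supportedM; first exact: (IHs m lt_ms lt_im).
exact/supported_lfrob/supported_Wtail.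
Qed.

End GhostSupports.

(** * Hasse-Witt matrices *)

Lemma eq_sum_support (I : eqType) (V : nmodType) (s t : seq I) (f : I -> V) :
  uniq s -> uniq t ->
  (forall x, x \notin s -> f x = 0) -> (forall x, x \notin t -> f x = 0) ->
  \sum_(x <- s) f x = \sum_(x <- t) f x.
Proof.
move=> s_uniq t_uniq fs ft.
rewrite (bigID (mem t)) /= [X in _ + X]big1 ?addr0 => [|x /ft//].
rewrite [RHS](bigID (mem s)) /= [X in _ = _ + X]big1 ?addr0 => [|x /fs//].
rewrite -big_filter -[RHS]big_filter; apply/perm_big/uniq_perm;
  rewrite ?filter_uniq //.
by move=> x; rewrite !mem_filter andbC.
Qed.

Section HasseWittProducts.
Variables (p r g : nat) (S : comNzRingType).
Local Notation T := (laurent r S).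
Implicit Types (F G W V : T) (Delta : g.-tuple 'rV[int]_r).

Lemma mcoeff_mul_lfrob q (phi : {rmorphism S -> S}) V W y :
  (V * lfrob q phi W)@_y = \sum_(w <- msupp W) V@_(y - w *+ q) * phi W@_w.
Proof.
rewrite [W in LHS]laurentE (raddf_sum (lfrob q phi)) mulr_sumr
  mcoeff_laurent_sum /=.
apply: eq_bigr => w _; rewrite lfrob_lterm mcoeff_laurentM.
under eq_bigr => u _ do rewrite mcoeff_lterm.
case: (msuppP V (y - w *+ q)) => [Vy|Vy].
  rewrite (bigD1_seq (y - w *+ q)) ?fset_uniq //= subKr eqxx.
  rewrite big1 ?addr0 // => u u_neq.
  by rewrite eq_sym subr_eq addrC -subr_eq eq_sym (negPf u_neq) mulr0.
rewrite mul0r big1_seq // => u /andP[_ u_in];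
  rewrite eq_sym subr_eq addrC -subr_eq.
by case: eqP u_in => [<-|_ _]; [rewrite (negPf Vy)|rewrite mulr0].
Qed.

(** The coefficient at $p^{b+m}v-u$ is a sum of $V_{p^{b+m}v-u-p^bw}\,\varphi(W_w)$. With $w=p^mv-q$
    the exponent of $V$ becomes $p^bq-u$, so by hypothesis $q$ runs over [Delta2], which is matrix
    multiplication. *)
Lemma hasse_witt_mul b m (phi : {rmorphism S -> S}) Delta1 Delta2 Delta3 V W :
  uniq Delta2 ->
  (forall u q, u \in Delta1 -> q *+ (p ^ b) - u \in msupp V -> q \in Delta2) ->
  hasse_witt p (b + m) Delta1 Delta3 (V * lfrob (p ^ b) phi W) =
  hasse_witt p b Delta1 Delta2 V *m map_mx phi (hasse_witt p m Delta2 Delta3 W).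
Proof.
move=> uniq2 suppV; apply/matrixP => i j; rewrite !mxE mcoeff_mul_lfrob.
set u := tnth Delta1 i; set v := tnth Delta3 j.
pose f w := V@_(v *+ p ^ (b + m) - u - w *+ p ^ b) * phi W@_w.
pose t := [seq v *+ p ^ m - x | x <- Delta2].
have expE x : v *+ p ^ (b + m) - u - (v *+ p ^ m - x) *+ p ^ b = x *+ p ^ b - u.
  rewrite mulrnBl -mulrnA -expnD [(m + b)%N]addnC opprB.
  by rewrite addrC subrKA.
rewrite (@eq_sum_support _ _ _ t f) ?fset_uniq //; last 3 first.
- by rewrite map_inj_uniq // => x y /addrI/oppr_inj.
- by move=> w /mcoeff_outdom Ww; rewrite /f Ww rmorph0 mulr0.
- move=> w w_t; rewrite /f.
  case: (msuppP V (v *+ p ^ (b + m) - u - w *+ p ^ b)) => [Vw|_];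
    last by rewrite mul0r.
  case/negP: w_t; apply/mapP; exists (v *+ p ^ m - w); last by rewrite subKr.
  apply: (suppV u); first exact: mem_tnth.
  by rewrite -expE subKr.
rewrite big_map big_tuple; apply: eq_bigr => k _.
by rewrite /f expE !mxE.
Qed.

Lemma hasse_witt_sum m Delta1 Delta2 (I : Type) (s : seq I) (P : pred I) (E : I
  -> T) :
  hasse_witt p m Delta1 Delta2 (\sum_(i <- s | P i) E i) =
  \sum_(i <- s | P i) hasse_witt p m Delta1 Delta2 (E i).
Proof.
apply/matrixP => i j; rewrite !mxE mcoeff_laurent_sum summxE.
by apply: eq_bigr => k _; rewrite mxE.
Qed.

Lemma hasse_witt1 Delta : uniq Delta ->
  hasse_witt p 0 Delta Delta (1 : T) = 1%:M.
Proof.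
move=> uniq_D; apply/matrixP => i j;
  rewrite !mxE expn0 mulr1n -[1 : T]lterm_one.
rewrite mcoeff_lterm [0 == _]eq_sym subr_eq0; congr (_ *+ nat_of_bool _).
by rewrite eq_sym; apply/eqP/eqP => [/(tuple_uniqP _ uniq_D)//|->//].
Qed.

Lemma cong_hasse_witt N m Delta1 Delta2 F :
  cong N F 0 -> cong N (hasse_witt p m Delta1 Delta2 F) 0.
Proof.
move/cong_laurent=> F0; apply/cong_mx => i j; rewrite !mxE.
by have := F0 (tnth Delta2 j *+ p ^ m - tnth Delta1 i); rewrite mcoeff0.
Qed.

End HasseWittProducts.

(** The point $p^Eq$ is the sum of $u$ and an exponent of $F$, so it lies in the intersection that
    admissibility at $(i,m-1)$ controls; dilation by $p^E$ is injective. *)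
Lemma admissible_mem (R : realType) p l g r (S : comNzRingType) e
    (Delta : nat -> g.-tuple 'rV[int]_r) (Lambda : nat ->
      laurent r S) i m (F : laurent r S) :
  (0 < p)%N -> admissible R p l e Delta Lambda -> (i < m <= l)%N ->
  supported F (newton_tail (R := R) p e Lambda i m) ->
  forall u q, u \in Delta i -> q *+ (p ^ esum e i m) - u \in msupp F ->
    q \in Delta m.
Proof.
move=> p_gt0 adm; case: m => // m i_bounds FA u q u_in /FA q_in.
have [|_ [w /= w_in <-]] := adm i m i_bounds (lattice_pt R (q *+ (p ^ esum e i
  m.+1))).
  split; last by exists (lattice_pt R q); [exists q|rewrite lattice_ptMn].
  apply/minkowskiP; exists (lattice_pt R u).
  exists (lattice_pt R (q *+ (p ^ esum e i m.+1) - u)); split.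
  - by exists u.
  - exact: q_in.
  - by rewrite -lattice_ptD addrC subrK.
rewrite -lattice_ptMn => /lattice_pt_inj/eqP.
rewrite -subr_eq0 -mulrnBl => /eqP wq.
suff -> : q = w by exact: w_in.
apply/eqP; rewrite eq_sym -subr_eq0; apply/eqP/matrixP => a b.
move/matrixP/(_ a b)/eqP: wq; rewrite mulmxnE !mxE mulrn_eq0 expn_eq0.
by rewrite (gtn_eqF p_gt0) /= => /eqP.
Qed.

Theorem theorem2p8 (R : realType) (p : nat) (p_pr : prime p) (p_odd : odd p)
    (r n l g : nat) (g_gt0 : (0 < g)%N)
    (e : nat -> nat) (e_gt0 : forall a, (1 <= a <= l.+1)%N -> (0 < e a)%N)
    (Delta : nat -> g.-tuple 'rV[int]_r)
    (Delta_uniq : forall i, (i <= l.+1)%N -> uniq (Delta i))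
    (Lambda : nat -> laurent r (laurent n (padic_int p_pr)))
    (Lambda_adm : admissible R p l e Delta Lambda)
    (det_neq0 : forall i, (i <= l)%N ->
       nonzero_modp p
         (\det (hasse_witt p (e i.+1) (Delta i) (Delta i.+1) (Lambda i))))
    (v : 'I_n) (s ell : nat) (s_bounds : (1 <= s <= l)%N) :
  let A (k : nat) : 'M[laurent n (padic_int p_pr)]_g :=
    hasse_witt p (esum e 0 k.+1) (Delta 0%N) (Delta k.+1) (Wprod p e Lambda k) in
  let sigmaA (k : nat) := map_mx (iter ell (@lsigma _ _ p)) (A k) in
  ratio_congr p (s + ell)
    (map_mx (lderiv v) (sigmaA s)) (sigmaA s)
    (map_mx (lderiv v) (sigmaA s.-1)) (sigmaA s.-1).
Proof.
move=> A0 sigmaA.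
set L := laurent n (padic_int p_pr).
have p_gt0 := prime_gt0 p_pr.
pose sig b : {rmorphism L -> L} := lfrob (p ^ b) idfun.
(* [sig] substitutes in $z$ alone, [tau] in both $t$ and $z$. *)
pose tau b : {rmorphism laurent r L -> laurent r L} := lfrob (p ^ b) (sig b).
have reg : regular_mod p L := laurent_regular_mod n (padic_regular_mod p_pr).
have sigD a b x : sig a (sig b x) = sig (a + b)%N x.
  rewrite /sig /= expnD.
  exact: (@lfrob_comp n _ (p ^ a) (p ^ b) idfun idfun idfun (fun=> erefl)).
have sig_neq0 a x : ~ cong p x 0 -> ~ cong p (sig a x) 0.
  by apply: lfrob_neq0_mod; rewrite expn_gt0 p_gt0.
have tauP a b F : (0 < b)%N ->
    cong (p ^ a.+1) (F ^+ (p ^ (b + a))) (tau b (F ^+ (p ^ a))).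
  move=> _; apply: cong_lfrob_exp => // c; apply: cong_lfrob_prime => // x.
  exact: padic_fermat.
have [V VE] := choice (ghosts_exist p e tau Lambda).
pose A i j := hasse_witt p (esum e i j) (Delta i) (Delta j) (Wtail p e Lambda i
  j).
pose B i j := hasse_witt p (esum e i j) (Delta i) (Delta j) (V i j).
have A_diag i : (i <= l.+1)%N -> A i i = 1%:M.
  by move=> le_il; rewrite /A esum0 Wtail_nil; apply/hasse_witt1/Delta_uniq.
have A_rec i j : (i < j <= l.+1)%N ->
    A i j = \sum_(i.+1 <= m < j.+1) B i m *m map_mx (sig (esum e i m)) (A m j).
  move=> /andP[lt_ij le_jl]; rewrite /A (VE i j lt_ij) hasse_witt_sum.
  apply: eq_big_nat => m /andP[lt_im]; rewrite ltnS leq_eqVlt.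
  case/orP=> [/eqP->|lt_mj].
    (* Admissibility reaches only $\Delta_l$ while $j$ may be $l+1$; the last term is settled by
       $A(j,j)=1$. *)
    by rewrite -/(A j j) A_diag // Wtail_nil rmorph1 mulr1 map_mx1 mulmx1.
  rewrite -(@esumD e i m j); last by rewrite (ltnW lt_im) (ltnW lt_mj).
  have le_ml : (m <= l)%N by rewrite -ltnS (leq_trans lt_mj).
  apply: hasse_witt_mul; first by apply: Delta_uniq; apply: leqW.
  apply: (admissible_mem p_gt0 Lambda_adm); first by rewrite lt_im.
  exact: supported_ghost (VE i) lt_im.
have B_cong i m : (i < m <= l.+1)%N -> cong (p ^ (m - i.+1)) (B i m) 0.
  by move=> m_bounds; apply/cong_hasse_witt/(ghost_cong tauP e_gt0 (VE i)
    m_bounds).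
(* The first ghost $V(i,i+1)$ is $\Lambda_i$, so $B(i,i+1)$ is the matrix assumed invertible. *)
have B_det i : (i <= l)%N -> ~ cong p (\det (B i i.+1)) 0.
  move=> le_il; have /nonzero_modpE := det_neq0 i le_il;
    congr (~ cong p (\det _) 0).
  rewrite /B esum1 (ghostE (VE i)) // big_geq // subr0.
  by rewrite WtailS // Wtail_nil esum0 mul1r expr1.
have D_sig a : exists u, forall x,
    lderiv v (sig a x) = u * sig a (lderiv v x) *+ p ^ a.
  eexists => x; apply: lderiv_lfrob; by rewrite expn_gt0 p_gt0.
have sigE : iter ell (@lsigma n (padic_int p_pr) p) = sig ell.
  by apply/funext => x; apply: iter_lsigma.
have sigmaAE k : sigmaA k = map_mx (sig ell) (A 0%N k.+1).
  by rewrite /sigmaA sigE.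
case/andP: s_bounds => s_gt0 le_sl; rewrite !sigmaAE prednK //.
have det_neq k : (k <= l.+1)%N ->
  ~ cong p (\det (map_mx (sig ell) (A 0%N k))) 0.
  move=> le_kl; rewrite det_map_mx; apply: (sig_neq0 ell _).
  exact: (det_A_neq0 reg sig_neq0 A_diag A_rec B_cong B_det).
split.
- by apply/nonzero_modpE/det_neq.
- by apply/nonzero_modpE/det_neq/leqW.
move=> i j; apply/lcongrE; rewrite -[s in (s + ell)%N]subn0.
exact: (sig_deriv_ratio_cong reg e_gt0 sigD sig_neq0 A_diag A_rec B_cong B_det
  le_sl (lderivM v) D_sig).
Qed.
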